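(* The Wallis sequence $W_n=\prod_{k=1}^{n}\frac{4k^2}{4k^2-1}$ $(n\in\mathbb{N})$ has the following asymptotic expansion: $$W_n\sim\frac{\pi}{2}\left(1+\sum_{\ell=1}^{\infty}\frac{\alpha_\ell}{(n+\beta_\ell)^{2\ell-1}}\right)\qquad(n\to\infty),$$ where $\alpha_\ell$ and $\beta_\ell$ are given by $\alpha_1=-\frac14$, $\beta_1=\frac58$ and the pair of recurrence relations $$\alpha_\ell=\mu_{2\ell-1}-\sum_{k=1}^{\ell-1}\alpha_k\beta_k^{2\ell-2k}\binom{2\ell-2}{2\ell-2k}\qquad(\ell\ge2)$$ and $$\beta_\ell=-\frac{1}{(2\ell-1)\alpha_\ell}\left\{\mu_{2\ell}+\sum_{k=1}^{\ell-1}\alpha_k\beta_k^{2\ell-2k+1}\binom{2\ell-1}{2\ell-2k+1}\right\}\qquad(\ell\ge2).$$ Here the numbers $\mu_j$ are given by the recurrence relation $$\mu_0=1,\qquad \mu_j=\frac1j\sum_{k=1}^{j}k\,\nu_k\,\mu_{j-k}\quad(j\ge1),$$ with $$\nu_j=\frac{(-1)^{j+1}\left((4-2^{1-j})B_{j+1}-(j+1)\cdot2^{-j}\right)}{j(j+1)}\qquad(j\ge1).$$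
   Context: $\mathbb{N}=\{1,2,3,\ldots\}$. $B_n$ denotes the Bernoulli numbers, defined by $\frac{z}{e^z-1}=\sum_{n=0}^\infty B_n\frac{z^n}{n!}$. The relation $\sim$ denotes an asymptotic expansion in the usual (Poincaré) sense: for every $N\ge1$, $W_n=\frac{\pi}{2}\left(1+\sum_{\ell=1}^{N}\frac{\alpha_\ell}{(n+\beta_\ell)^{2\ell-1}}\right)+O(n^{-2N-1})$ as $n\to\infty$. The series need not converge. *)

(* Defs.v *)
From Stdlib Require Import Reals ZArith Factorial.
From Coquelicot Require Import Coquelicot.
Open Scope R_scope.

(* [B] is the sequence of Taylor coefficients (times n!) at 0 of z / (e^z - 1).
   The point z = 0, where the quotient has a removable singularity, is left out
   because Rocq's total division gives no information there. *)
Definition is_bernoulli (B : nat -> R) : Prop :=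
  exists r : R, 0 < r /\
    forall z : R, 0 < Rabs z < r ->
      is_pseries (fun n => B n / INR (fact n)) z (z / (exp z - 1)).

Fixpoint wallis (n : nat) : R :=
  match n with
  | O => 1
  | S m => wallis m * (4 * INR n ^ 2 / (4 * INR n ^ 2 - 1))
  end.

Definition big_O (f g : nat -> R) : Prop :=
  exists K : R, eventually (fun n => Rabs (f n) <= K * Rabs (g n)).

(* W_n ~ c (1 + sum_{l >= 1} alpha_l / (n + beta_l)^(2l-1)) in the sense of
   Poincare, the remainder after N terms being O(n^(-2N-1)). *)
Definition asymptotic_expansion
    (W : nat -> R) (c : R) (alpha beta : nat -> R) : Prop :=
  forall N : nat, (1 <= N)%nat ->
    big_O
      (fun n => W n - c * (1 + sum_n_m
         (fun l => alpha l / (INR n + beta l) ^ (2 * l - 1)) 1 N))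
      (fun n => powerRZ (INR n) (- 2 * Z.of_nat N - 1)).

(* Main.v *)
Require Import Defs.
From Stdlib Require Import Reals ZArith Lra Lia.
From Coquelicot Require Import Coquelicot.
Open Scope R_scope.

(** Put [x = n + 1 / 2].  The recurrences for [alpha] and [beta] say exactly that
    the first [N] terms of the proposed expansion agree with the expansion
    [sum mu_j n ^ (- j)] of [W_n / (PI / 2)] up to [n ^ (- 2 N)]; for [beta_l] this
    requires [alpha_l <> 0], which is the heart of the matter.

    The Bernoulli numbers give the Borel transform of [ln (W_n / (PI / 2))] in the
    variable [x]: it is [- tanh (t / 4) / t].  The expansion of the logarithm then
    follows by telescoping [ln W_(n+1) - ln W_n], the constant being Wallis'
    limit, and [mu] is obtained by translating [x] to [n] and exponentiating.

    For [alpha_l <> 0] one works in the variable [x] with [gamma_l = beta_l - 1 / 2].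
    Let [t_k] be the coefficients of [tan].  After normalization the coefficients
    of degrees [2 k + 1] and [2 k + 2] of [W_n / (PI / 2)] become [p_k <= t_k] and
    [q_k <= 9 / 8 t_k], with [p_k] not much smaller than [t_k], and the defining
    relations become
      [p_k = sum_i (-1)^i A_(k-i) g_(k-i)^(2i) / (2i)!] and
      [q_k / (2k+1) = sum_i (-1)^i A_(k-i) g_(k-i)^(2i+1) / (2i+1)!],
    where [A_k] is a nonzero multiple of [alpha_(k+1)] and [g_k = 4 gamma_(k+1)].
    Since [t_k <= 3 t_(k+1)], the bounds [0 < A_k <= 5 / 3 t_k] and
    [|g_k| <= 1 / 2] propagate by induction on [k]. *)

(** * Wallis' limit *)

(** The coefficients [logc] grow factorially, so the expansion of the logarithm diverges. Identities
    between coefficients are therefore proved on the Borel side, where [tau] is analytic at 0, and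
    only truncations are exponentiated. If [alpha_l] vanished, no shift could correct degree [2 l],
    and [beta_l] would be the value of a division by 0. The recurrences are nonlinear in the shifts,
    so non-vanishing is drawn from inequalities strong enough to reproduce themselves. Centring at
    [n + 1 / 2] makes the logarithm odd, which decouples the parities, and keeps the shifts small.
    Origin of the constants: [t_k <= 3 t_(k+1)] and [|g_k| <= 1 / 2] put [(3 / 4)^i / (2 i)!] in
    front of the [i]-th correction to [A_k]. These weights sum to at most [2 / 5], and [5 / 3] is
    the solution of [x = 1 + 2 / 5 x]. The bound [1 / 2] is attained by [g_0]. *)

Definition sin_pow_int (n : nat) : R := RInt (fun x => sin x ^ n) 0 (PI / 2).

Lemma continuous_sin_pow (n : nat) (x : R) : continuous (fun x => sin x ^ n) x.
Proof.
apply (ex_derive_continuous (fun x => sin x ^ n)); auto_derive; trivial.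
Qed.

Lemma ex_sin_pow_int (n : nat) : ex_RInt (fun x => sin x ^ n) 0 (PI / 2).
Proof.
apply (ex_RInt_continuous (fun x => sin x ^ n)).
intros; apply continuous_sin_pow.
Qed.

(** Integration by parts in disguise: the primitive [F] vanishes at both ends of the interval, and
    [cos ^ 2 = 1 - sin ^ 2] turns its derivative into [f]. *)
Lemma sin_pow_int_rec (n : nat) :
  INR (n + 2) * sin_pow_int (S (S n)) = INR (n + 1) * sin_pow_int n.
Proof.
set (F := fun x => - cos x * sin x ^ S n).
set (f := fun x => INR (n + 2) * sin x ^ S (S n) - INR (n + 1) * sin x ^ n).
assert (is_RInt f 0 (PI / 2) (minus (F (PI / 2)) (F 0))) as H1.
{ apply (is_RInt_derive F f).
  - intros x _; unfold F, f; auto_derive; trivial.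
    replace (INR (n + 2)) with (INR n + 2) by (rewrite plus_INR; reflexivity).
    replace (INR (n + 1)) with (INR n + 1) by (rewrite plus_INR; reflexivity).
    change (match n with 0%nat => 1 | S _ => INR n + 1 end) with (INR (S n)).
    rewrite S_INR.
    simpl pred; simpl pow.
    generalize (sin2_cos2 x); unfold Rsqr; intros E.
    replace (cos x * 1 * ((INR n + 1) * sin x ^ n) ) with
      ((INR n + 1) * (cos x * sin x ^ n)) by ring.
    replace (- cos x * ((INR n + 1) * cos x * sin x ^ n))
      with (- (INR n + 1) * (1 - sin x * sin x) * sin x ^ n)
      by (rewrite <- E; ring).
    ring_simplify.
    replace (cos x ^ 2) with (1 - sin x * sin x) by (rewrite <- E; ring).
    ring.
  - intros x _; apply (ex_derive_continuous f); unfold f; auto_derive; trivial. }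
assert (is_RInt f 0 (PI / 2)
  (INR (n + 2) * sin_pow_int (S (S n)) - INR (n + 1) * sin_pow_int n)) as H2.
{ apply (is_RInt_minus (fun x => INR (n + 2) * sin x ^ S (S n))
    (fun x => INR (n + 1) * sin x ^ n));
    (apply (is_RInt_scal (fun x => sin x ^ _));
     exact (RInt_correct _ _ _ (ex_sin_pow_int _))). }
assert (minus (F (PI / 2)) (F 0)
  = INR (n + 2) * sin_pow_int (S (S n)) - INR (n + 1) * sin_pow_int n) as E
  by (rewrite <- (is_RInt_unique _ _ _ _ H1); exact (is_RInt_unique _ _ _ _ H2)).
unfold minus, plus, opp, F in E; simpl in E.
rewrite cos_PI2, sin_0 in E; lra.
Qed.

Lemma sin_0_PI2 (x : R) : 0 < x < PI / 2 -> 0 < sin x <= 1.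
Proof.
intros Hx; split; [apply sin_gt_0; generalize PI_RGT_0; lra|apply SIN_bound].
Qed.

Lemma sin_pow_int_decr (n : nat) : sin_pow_int (S n) <= sin_pow_int n.
Proof.
apply RInt_le; try apply ex_sin_pow_int; [generalize PI_RGT_0; lra|].
intros x Hx; destruct (sin_0_PI2 x Hx) as [H0 H1].
generalize (pow_lt _ n H0); simpl; nra.
Qed.

Lemma sin_pow_int_pos (n : nat) : 0 < sin_pow_int n.
Proof.
apply RInt_gt_0; [generalize PI_RGT_0; lra| |].
- intros x Hx; apply pow_lt, sin_0_PI2, Hx.
- intros; apply continuous_sin_pow.
Qed.

(** One factor of the product is the quotient of two instances of the recurrence for the integrals,
    at [2 n] and at [2 n + 1]. *)
Lemma wallis_sin_pow_int (n : nat) :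
  wallis n * sin_pow_int (2 * n) = PI / 2 * sin_pow_int (S (2 * n)).
Proof.
induction n as [|n IH].
- simpl; unfold sin_pow_int.
  rewrite (RInt_ext _ (fun _ => 1)) by (intros; simpl; ring).
  rewrite RInt_const.
  assert (RInt (fun x => sin x ^ 1) 0 (PI / 2) = 1) as E.
  { apply is_RInt_unique.
    replace 1 with (minus (- cos (PI / 2)) (- cos 0))
      by (rewrite cos_PI2, cos_0; unfold minus, plus, opp; simpl; ring).
    apply (is_RInt_derive (fun x => - cos x) (fun x => sin x ^ 1)).
    - intros x _; auto_derive; trivial; ring.
    - intros; apply continuous_sin_pow. }
  rewrite E; unfold scal; simpl; unfold mult; simpl; ring.
- generalize (sin_pow_int_rec (2 * n)) (sin_pow_int_rec (S (2 * n))).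
  replace (2 * S n)%nat with (S (S (2 * n))) by lia.
  intros E1 E2.
  assert (INR (2 * n + 2) = 2 * INR (S n)) as H1
    by (rewrite plus_INR, mult_INR, (S_INR n); simpl; ring).
  assert (INR (2 * n + 1) = 2 * INR (S n) - 1) as H2
    by (rewrite plus_INR, mult_INR, (S_INR n); simpl; ring).
  assert (INR (S (2 * n) + 1) = 2 * INR (S n)) as H3
    by (rewrite plus_INR, (S_INR (2 * n)), mult_INR, (S_INR n); simpl; ring).
  assert (INR (S (2 * n) + 2) = 2 * INR (S n) + 1) as H4
    by (rewrite plus_INR, (S_INR (2 * n)), mult_INR, (S_INR n); simpl; ring).
  rewrite H1, H2 in E1; rewrite H3, H4 in E2.
  cbn [wallis].
  assert (1 <= INR (S n)) as Hn by (rewrite S_INR; generalize (pos_INR n); lra).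
  set (x := INR (S n)) in *.
  replace (sin_pow_int (S (S (2 * n)))) with
    ((2 * x - 1) * sin_pow_int (2 * n) / (2 * x))
    by (rewrite <- E1; field; lra).
  replace (sin_pow_int (S (S (S (2 * n))))) with
    (2 * x * sin_pow_int (S (2 * n)) / (2 * x + 1))
    by (rewrite <- E2; field; lra).
  replace (4 * x ^ 2 - 1) with ((2 * x - 1) * (2 * x + 1)) by ring.
  replace (PI / 2 * (2 * x * sin_pow_int (S (2 * n)) / (2 * x + 1))) with
    (PI / 2 * sin_pow_int (S (2 * n)) * (2 * x / (2 * x + 1)))
    by (field; lra).
  rewrite <- IH.
  field; lra.
Qed.

Lemma wallis_pos (n : nat) : 0 < wallis n.
Proof.
generalize (wallis_sin_pow_int n) (sin_pow_int_pos (2 * n))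
  (sin_pow_int_pos (S (2 * n))) PI_RGT_0; intros E H1 H2 H3.
apply (Rmult_lt_reg_r (sin_pow_int (2 * n))); trivial.
rewrite E, Rmult_0_l; apply Rmult_lt_0_compat; lra.
Qed.

Lemma wallis_lim : is_lim_seq wallis (PI / 2).
Proof.
(* The integrals decrease with the exponent, so the quotient of those of exponents [2 n + 1] and
   [2 n] lies between [(2 n + 1) / (2 n + 2)] and 1. The lower sequence is slightly weaker than
   this. *)
apply is_lim_seq_le_le with
  (fun n => PI / 2 - PI / 2 * / (INR n + 1)) (fun _ => PI / 2).
- intros n.
  generalize (wallis_sin_pow_int n) (sin_pow_int_pos (2 * n))
    (sin_pow_int_decr (2 * n)) (sin_pow_int_decr (S (2 * n)))
    (sin_pow_int_rec (2 * n)) PI_RGT_0.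
  replace (INR (2 * n + 2)) with (2 * (INR n + 1))
    by (rewrite plus_INR, mult_INR; simpl; ring).
  replace (INR (2 * n + 1)) with (2 * INR n + 1)
    by (rewrite plus_INR, mult_INR; simpl; ring).
  set (a := sin_pow_int (2 * n)); set (b := sin_pow_int (S (2 * n))).
  set (d := sin_pow_int (S (S (2 * n)))).
  intros E Ha Hb Hd Er Hpi.
  generalize (pos_INR n); intros Hn.
  split; apply (Rmult_le_reg_r a); trivial; rewrite E;
    [|apply Rmult_le_compat_l; lra].
  replace ((PI / 2 - PI / 2 * / (INR n + 1)) * a) with
    (PI / 2 * ((2 * INR n + 1) * a / (2 * (INR n + 1))
               - a / (2 * (INR n + 1)))) by (field; lra).
  rewrite <- Er.
  apply Rmult_le_compat_l; [lra|].
  assert (0 < a / (2 * (INR n + 1))) by (apply Rdiv_lt_0_compat; lra).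
  replace (2 * (INR n + 1) * d / (2 * (INR n + 1))) with d by (field; lra).
  lra.
- replace (Finite (PI / 2)) with (Finite (PI / 2 - PI / 2 * 0))
    by (f_equal; ring).
  apply is_lim_seq_minus'; [apply is_lim_seq_const|].
  apply is_lim_seq_mult'; [apply is_lim_seq_const|].
  apply (is_lim_seq_inv (fun n => INR n + 1) p_infty); [|discriminate].
  apply is_lim_seq_plus with p_infty 1;
    [apply is_lim_seq_INR|apply is_lim_seq_const|reflexivity].
- apply is_lim_seq_const.
Qed.

(** * Asymptotic expansions along a null sequence *)

Lemma sum_n_m_from_1 (a : nat -> R) (n : nat) :
  sum_n_m a 1 (S n) = sum_f_R0 (fun k => a (S k)) n.
Proof.
rewrite <- sum_n_m_S.
apply sum_n_Reals.
Qed.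

Lemma sum_even_odd (a : nat -> R) (n : nat) :
  sum_f_R0 a (2 * n + 1)
  = sum_f_R0 (fun i => a (2 * i)%nat + a (2 * i + 1)%nat) n.
Proof.
induction n as [|n IH].
- reflexivity.
- replace (2 * S n + 1)%nat with (S (S (2 * n + 1))) by lia.
  rewrite 2!tech5, IH, tech5.
  replace (S (2 * n + 1)) with (2 * S n)%nat by lia.
  replace (S (2 * S n)) with (2 * S n + 1)%nat by lia.
  ring.
Qed.

Lemma sum_f_R0_0 (a : nat -> R) (n : nat) :
  (forall i, (i <= n)%nat -> a i = 0) -> sum_f_R0 a n = 0.
Proof.
intros H.
rewrite (sum_eq _ (fun _ => 0)) by exact H.
rewrite sum_cte; ring.
Qed.

Lemma sum_f_R0_rev (a : nat -> R) (n : nat) :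
  sum_f_R0 a n = sum_f_R0 (fun i => a (n - i)%nat) n.
Proof.
revert a; induction n as [|n IH]; intros a.
- reflexivity.
- rewrite decomp_sum by lia.
  rewrite tech5, Nat.sub_diag, Rplus_comm; f_equal.
  simpl pred.
  rewrite IH.
  apply sum_eq; intros i Hi; f_equal; lia.
Qed.

Lemma sum_geometric_le (x : R) (n : nat) :
  0 <= x < 1 -> sum_f_R0 (fun i => x ^ i) n <= / (1 - x).
Proof.
intros Hx.
rewrite tech3 by lra.
rewrite <- (Rmult_1_l (/ (1 - x))).
apply Rmult_le_compat_r.
- left; apply Rinv_0_lt_compat; lra.
- assert (0 <= x ^ S n) by (apply pow_le; lra); lra.
Qed.

Lemma Rabs_le_sum (a : nat -> R) (j n : nat) :
  (j <= n)%nat -> Rabs (a j) <= sum_f_R0 (fun i => Rabs (a i)) n.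
Proof.
intros H; induction H as [|n H IH].
- destruct j as [|j]; [simpl; lra|].
  rewrite tech5.
  assert (0 <= sum_f_R0 (fun i => Rabs (a i)) j)
    by (apply cond_pos_sum; intros; apply Rabs_pos); lra.
- rewrite tech5.
  generalize (Rabs_pos (a (S n))); lra.
Qed.

(** The step [e] is a parameter because the same function is expanded both in [/ INR n] and in
    [half_step]. *)
Definition expands (e a F : nat -> R) : Prop :=
  forall M : nat, exists K : R, eventually (fun n =>
    Rabs (F n - sum_f_R0 (fun j => a j * e n ^ j) M) <= K * Rabs (e n) ^ S M).

Lemma expands_ext (e a b F G : nat -> R) :
  (forall j, a j = b j) -> eventually (fun n => F n = G n) ->
  expands e a F -> expands e b G.
Proof.
intros Hab HFG H M.
destruct (H M) as [K HK].
exists K.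
generalize (filter_and _ _ HFG HK).
apply filter_imp; intros n [Hn HKn].
rewrite <- Hn.
rewrite (sum_eq (fun j => b j * e n ^ j) (fun j => a j * e n ^ j)).
- exact HKn.
- intros i _; rewrite Hab; reflexivity.
Qed.

Lemma expands_lin (e a b F G : nat -> R) (x : R) :
  expands e a F -> expands e b G ->
  expands e (fun j => a j + x * b j) (fun n => F n + x * G n).
Proof.
intros HF HG M.
destruct (HF M) as [K HK].
destruct (HG M) as [L HL].
exists (K + Rabs x * L).
generalize (filter_and _ _ HK HL).
apply filter_imp; intros n [Hn HKn].
replace (F n + x * G n - _) with
  ((F n - sum_f_R0 (fun j => a j * e n ^ j) M)
   + x * (G n - sum_f_R0 (fun j => b j * e n ^ j) M)).
2:{ rewrite (sum_eq (fun j => (a j + x * b j) * e n ^ j)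
      (fun j => a j * e n ^ j + b j * e n ^ j * x)) by (intros; ring).
    rewrite plus_sum, <- scal_sum; ring. }
eapply Rle_trans; [apply Rabs_triang|].
rewrite Rabs_mult.
generalize (Rmult_le_compat_l (Rabs x) _ _ (Rabs_pos x) HKn).
lra.
Qed.

Lemma expands_sum (e : nat -> R) (a F : nat -> nat -> R) (x : nat -> R) (m : nat) :
  (forall k, expands e (a k) (F k)) ->
  expands e (fun j => sum_f_R0 (fun k => x k * a k j) m)
    (fun n => sum_f_R0 (fun k => x k * F k n) m).
Proof.
assert (expands e (fun _ => 0) (fun _ => 0)) as H0.
{ intros M; exists 0.
  exists 0%nat; intros n _.
  rewrite sum_f_R0_0 by (intros; ring).
  rewrite Rminus_0_r, Rabs_R0; lra. }
intros H; induction m as [|m IH].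
- generalize (expands_lin e _ _ _ _ (x 0%nat) H0 (H 0%nat)).
  apply expands_ext; [intros j|exists 0%nat; intros n _]; simpl; ring.
- exact (expands_lin e _ _ _ _ (x (S m)) IH (H (S m))).
Qed.

Lemma is_lim_seq_0_eventually_lt (e : nat -> R) (r : R) :
  is_lim_seq e 0 -> 0 < r -> eventually (fun n => Rabs (e n) < r).
Proof.
intros He Hr.
apply is_lim_seq_spec in He.
generalize (He (mkposreal r Hr)).
apply filter_imp; intros n Hn; simpl in Hn.
rewrite Rminus_0_r in Hn; exact Hn.
Qed.

(** Once the lower coefficients vanish, the estimate of order [j] divided by [|e n| ^ j] leaves
    [|a j| <= K |e n|], which tends to 0. *)
Lemma expands_zero (e a : nat -> R) :
  is_lim_seq e 0 -> eventually (fun n => e n <> 0) -> expands e a (fun _ => 0) ->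
  forall j, a j = 0.
Proof.
intros He He0 H j.
induction j as [j IH] using (well_founded_induction lt_wf).
destruct (H j) as [K HK].
assert (forall n, sum_f_R0 (fun i => a i * e n ^ i) j = a j * e n ^ j) as Hs.
{ intros n; destruct j as [|j].
  - reflexivity.
  - rewrite tech5, sum_f_R0_0; [ring|].
    intros i Hi; rewrite IH by lia; ring. }
assert (is_lim_seq (fun n => Rabs (a j)) 0) as Hl.
{ apply is_lim_seq_le_le_loc with (fun _ => 0) (fun n => K * Rabs (e n)).
  - generalize (filter_and _ _ He0 HK); apply filter_imp; intros n [Hn0 Hn].
    split; [apply Rabs_pos|].
    rewrite Hs, Rminus_0_l, Rabs_Ropp, Rabs_mult, <- RPow_abs in Hn.
    assert (0 < Rabs (e n) ^ j) by (apply pow_lt, Rabs_pos_lt, Hn0).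
    simpl in Hn.
    apply (Rmult_le_reg_r (Rabs (e n) ^ j)); lra.
  - apply is_lim_seq_const.
  - replace (Finite 0) with (Rbar_mult K 0)
      by (simpl; f_equal; ring).
    apply is_lim_seq_scal_l.
    apply -> is_lim_seq_abs_0; exact He. }
apply is_lim_seq_unique in Hl.
rewrite Lim_seq_const in Hl.
injection Hl; intros E.
destruct (Req_dec (a j) 0) as [Ha|Ha]; [exact Ha|].
apply Rabs_pos_lt in Ha; lra.
Qed.

Lemma expands_unique (e a b F : nat -> R) :
  is_lim_seq e 0 -> eventually (fun n => e n <> 0) ->
  expands e a F -> expands e b F -> forall j, a j = b j.
Proof.
intros He He0 Ha Hb j.
assert (a j + (-1) * b j = 0) as H.
{ apply (expands_zero e (fun j => a j + (-1) * b j)); trivial.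
  generalize (expands_lin e a b F F (-1) Ha Hb).
  apply expands_ext; [reflexivity|exists 0%nat; intros; ring]. }
lra.
Qed.

Lemma eventually_half_le (e : nat -> R) (s : R) :
  is_lim_seq e 0 -> eventually (fun n => / 2 <= 1 + s * e n).
Proof.
intros He.
assert (0 < / (2 * (Rabs s + 1))) as H0
  by (apply Rinv_0_lt_compat; generalize (Rabs_pos s); lra).
generalize (is_lim_seq_0_eventually_lt e _ He H0).
apply filter_imp; intros n Hn.
assert (/ (2 * (Rabs s + 1)) * (2 * (Rabs s + 1)) = 1) as E
  by (apply Rinv_l; generalize (Rabs_pos s); lra).
assert (Rabs (s * e n) <= / 2) as H
  by (rewrite Rabs_mult; generalize (Rabs_pos s) (Rabs_pos (e n)); nra).
apply Rabs_le_between in H; lra.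
Qed.

Lemma Rabs_inv_le_2 (x : R) : / 2 <= x -> Rabs (/ x) <= 2.
Proof.
intros H.
rewrite Rabs_pos_eq by (left; apply Rinv_0_lt_compat; lra).
replace 2 with (/ / 2) by field.
apply Rinv_le_contravar; lra.
Qed.

(** [pw s k] lists the coefficients of [(e / (1 + s e)) ^ k], that is of
    [(y + s) ^ (- k)] in powers of [1 / y]. *)
Fixpoint pw (s : R) (k j : nat) : R :=
  match j, k with
  | O, O => 1
  | O, S _ => 0
  | S _, O => 0
  | S j', S k' => pw s k' j' - s * pw s k j'
  end.

Lemma expands_pw (e : nat -> R) (s : R) (k : nat) :
  is_lim_seq e 0 ->
  expands e (pw s k) (fun n => (e n / (1 + s * e n)) ^ k).
Proof.
intros He; induction k as [|k IH].
- intros M; exists 0; exists 0%nat; intros n _.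
  replace (sum_f_R0 _ M) with 1.
  + simpl pow; unfold Rminus; rewrite Rplus_opp_r, Rabs_R0; lra.
  + induction M as [|M IH]; [simpl; ring|].
    rewrite tech5, <- IH; simpl; ring.
- intros M.
  destruct (IH M) as [K HK].
  set (b := pw s (S k)).
  exists (2 * (Rabs K + Rabs (b (S M)))).
  generalize (filter_and _ _ (eventually_half_le e s He) (filter_and _ _
    (is_lim_seq_0_eventually_lt e 1 He Rlt_0_1) HK)).
  apply filter_imp; intros n [Hd [Hx HKn]].
  set (x := e n) in *.
  (* The recurrence of [pw] is multiplication by [1 + s x], so the product of this factor with a
     truncation leaves a single boundary term. *)
  assert (forall N, sum_f_R0 (fun j => b j * x ^ j) N * (1 + s * x)
    = x * sum_f_R0 (fun j => pw s k j * x ^ j) N - b (S N) * x ^ S N) as E.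
  { intros N; induction N as [|N IHN].
    - unfold b; simpl; ring.
    - rewrite 2!tech5, Rmult_plus_distr_r, IHN.
      change (b (S (S N))) with (pw s k (S N) - s * b (S N)).
      simpl; ring. }
  specialize (E M).
  set (T := sum_f_R0 (fun j => b j * x ^ j) M) in *.
  set (T' := sum_f_R0 (fun j => pw s k j * x ^ j) M) in *.
  set (G := (x / (1 + s * x)) ^ k) in *.
  replace ((x / (1 + s * x)) ^ S k - T) with
    ((x * (G - T') + b (S M) * x ^ S M) * / (1 + s * x)).
  2:{ change ((x / (1 + s * x)) ^ S k) with (x / (1 + s * x) * G).
      replace (x * (G - T') + b (S M) * x ^ S M)
        with (x * G - T * (1 + s * x)) by (rewrite E; ring).
      field; lra. }
  rewrite Rabs_mult, Rmult_comm.
  generalize (Rabs_inv_le_2 _ Hd); intros Hi.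
  assert (Rabs (x * (G - T') + b (S M) * x ^ S M)
    <= (Rabs K + Rabs (b (S M))) * Rabs x ^ S M) as Hm.
  { eapply Rle_trans; [apply Rabs_triang|].
    rewrite 2!Rabs_mult, <- (RPow_abs x (S M)).
    assert (0 <= Rabs x ^ S M) by (apply pow_le, Rabs_pos).
    assert (K * Rabs x ^ S M <= Rabs K * Rabs x ^ S M)
      by (apply Rmult_le_compat_r; [trivial|apply Rle_abs]).
    generalize (Rabs_pos x) (Rabs_pos (G - T')); nra. }
  rewrite Rmult_assoc.
  apply Rmult_le_compat; trivial; apply Rabs_pos.
Qed.

Lemma pw_lt (s : R) (k j : nat) : (j < k)%nat -> pw s k j = 0.
Proof.
revert k; induction j as [|j IH]; intros [|k] H; simpl; try lia; trivial.
rewrite 2!IH by lia; ring.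
Qed.

Lemma pw_diag (s : R) (k : nat) : pw s k k = 1.
Proof.
induction k as [|k IH]; [reflexivity|].
simpl; rewrite IH, pw_lt by lia; ring.
Qed.

(** These are the coefficients of the negative binomial series, and the recurrence of [pw] is
    Pascal's rule. *)
Lemma pw_closed (s : R) (k m : nat) :
  pw s (S k) (S k + m)
  = INR (fact (k + m)) / (INR (fact m) * INR (fact k)) * (- s) ^ m.
Proof.
assert (forall n, INR (fact n) <> 0) as Hf by (intros n; apply INR_fact_neq_0).
revert k; induction m as [|m IHm]; intros k.
- rewrite 2!Nat.add_0_r, pw_diag; simpl; field; apply Hf.
- induction k as [|k IHk].
  + change (0 - s * pw s 1 (0 + S m) = INR (fact (0 + S m)) /
      (INR (fact (S m)) * INR (fact 0)) * (- s) ^ S m).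
    change (0 + S m)%nat with (1 + m)%nat; rewrite IHm.
    change (1 + m)%nat with (S m); simpl pow.
    change (0 + m)%nat with m; change (0 + S m)%nat with (S m).
    field; repeat split; apply Hf.
  + change (pw s (S k) (S k + S m) - s * pw s (S (S k)) (S k + S m) =
      INR (fact (S k + S m)) /
      (INR (fact (S m)) * INR (fact (S k))) * (- s) ^ S m).
    rewrite IHk.
    replace (S k + S m)%nat with (S (S k) + m)%nat by lia.
    rewrite IHm.
    replace (k + S m)%nat with (S k + m)%nat by lia.
    change (S (S k) + m)%nat with (S (S k + m)).
    rewrite (fact_simpl (S k + m)), (fact_simpl m), (fact_simpl k), 3!mult_INR.
    rewrite (S_INR (S k + m)), (plus_INR (S k)), !S_INR.
    simpl pow.
    generalize (pos_INR m) (pos_INR k); intros.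
    field; repeat split; try apply Hf; lra.
Qed.

Lemma expands_reexpand (e e' a F : nat -> R) (s : R) :
  is_lim_seq e 0 -> eventually (fun n => e' n = e n / (1 + s * e n)) ->
  expands e' a F ->
  expands e (fun j => sum_f_R0 (fun k => a k * pw s k j) j) F.
Proof.
intros He He' H M.
destruct (H M) as [K HK].
destruct (expands_sum e (pw s) (fun k n => (e n / (1 + s * e n)) ^ k) a M
  (fun k => expands_pw e s k He) M) as [L HL].
(* Eventually [|e'| <= 2 |e|], which costs [2 ^ S M] in the remainder; [L] comes from re-expanding
   the finitely many powers of [e']. *)
exists (Rabs K * 2 ^ S M + L).
generalize (filter_and _ _ (filter_and _ _ He' (eventually_half_le e s He))
  (filter_and _ _ HK HL)).
apply filter_imp; intros n [[Hn Hd] [HKn HLn]].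
rewrite Hn in HKn.
set (x := e n) in *.
assert (Rabs (x / (1 + s * x)) <= 2 * Rabs x) as Hq.
{ unfold Rdiv; rewrite Rabs_mult, Rmult_comm.
  apply Rmult_le_compat_r; [apply Rabs_pos|apply Rabs_inv_le_2, Hd]. }
set (u := x / (1 + s * x)) in *.
(* The inner sum may run up to [M] instead of [j], since [pw s k j] vanishes for [j < k]. *)
rewrite (sum_eq _ (fun j => sum_f_R0 (fun k => a k * pw s k j) M * x ^ j)).
2:{ intros j Hj; f_equal.
    clear - Hj; induction Hj as [|M Hj IH]; [reflexivity|].
    rewrite tech5, <- IH, pw_lt by lia; ring. }
set (P := sum_f_R0 (fun k => a k * u ^ k) M) in *.
replace (F n - _) with
  ((F n - P) + (P - sum_f_R0 (fun j => sum_f_R0 (fun k => a k * pw s k j) M * x ^ j) M))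
  by ring.
eapply Rle_trans; [apply Rabs_triang|].
rewrite Rmult_plus_distr_r.
apply Rplus_le_compat; trivial.
eapply Rle_trans; [exact HKn|].
apply Rle_trans with (Rabs K * Rabs u ^ S M).
- apply Rmult_le_compat_r; [apply pow_le, Rabs_pos|apply Rle_abs].
- rewrite Rmult_assoc, <- Rpow_mult_distr.
  apply Rmult_le_compat_l; [apply Rabs_pos|].
  apply pow_incr; split; [apply Rabs_pos|exact Hq].
Qed.

(** * Convergent power series and exponentials of asymptotic series *)

Lemma CV_radius_pos (a : nat -> R) (r K : R) :
  0 < r -> (forall n, Rabs (a n * r ^ n) <= K) -> Rbar_lt 0 (CV_radius a).
Proof.
intros Hr H.
apply Rbar_lt_le_trans with r; [exact Hr|].
apply (proj1 (CV_radius_bounded a)).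
exists K; exact H.
Qed.

Lemma CV_radius_pos_ball (a : nat -> R) :
  Rbar_lt 0 (CV_radius a) ->
  exists r, 0 < r /\ forall x, Rabs x < r -> Rbar_lt (Rabs x) (CV_radius a).
Proof.
intros H; destruct (CV_radius a) as [r| |].
- exists r; split; trivial.
- exists 1; split; [lra|]; intros; exact I.
- destruct H.
Qed.

(** The tail is [e n ^ S M] times another power series [b], which is continuous at 0 and hence
    eventually bounded by [|b(0)| + 1]. *)
Lemma expands_PSeries (e a : nat -> R) :
  is_lim_seq e 0 -> Rbar_lt 0 (CV_radius a) ->
  expands e a (fun n => PSeries a (e n)).
Proof.
intros He Ha M.
set (b := PS_decr_n a (S M)).
exists (Rabs (PSeries b 0) + 1).
assert (continuity_pt (PSeries b) 0) as Hc.
{ apply PSeries_continuity.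
  replace (CV_radius b) with (CV_radius a); [rewrite Rabs_R0; exact Ha|].
  unfold b; clear; generalize (S M); intros N; induction N as [|N IH]; [reflexivity|].
  rewrite IH, <- CV_radius_decr_1.
  apply CV_radius_ext; intros k; unfold PS_decr_1, PS_decr_n; f_equal; lia. }
destruct (CV_radius_pos_ball a Ha) as [r [Hr Hball]].
destruct (proj1 (continuity_pt_locally _ _) Hc (mkposreal 1 Rlt_0_1)) as [d Hd].
generalize (is_lim_seq_0_eventually_lt e (Rmin r d) He
  (Rmin_pos _ _ Hr (cond_pos d))).
apply filter_imp; intros n Hn.
rewrite (PSeries_decr_n a M) by (apply CV_radius_inside, Hball;
  eapply Rlt_le_trans; [exact Hn|apply Rmin_l]).
replace (_ + _ - _) with (e n ^ S M * PSeries b (e n)) by (unfold b; ring).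
rewrite Rabs_mult, RPow_abs, Rmult_comm.
apply Rmult_le_compat_r; [apply Rabs_pos|].
assert (Rabs (PSeries b (e n) - PSeries b 0) < 1) as H1.
{ apply (Hd (e n)).
  change (Rabs (e n - 0) < d); rewrite Rminus_0_r.
  eapply Rlt_le_trans; [exact Hn|apply Rmin_r]. }
replace (PSeries b (e n)) with
  (PSeries b 0 + (PSeries b (e n) - PSeries b 0)) by ring.
eapply Rle_trans; [apply Rabs_triang|lra].
Qed.

(** [m] lists the coefficients of the exponential of the series [a], which has
    no constant term: this is the equation [m' = a' m]. *)
Definition exp_coefs (a m : nat -> R) : Prop :=
  m 0%nat = 1 /\ forall j, INR (S j) * m (S j)
    = sum_f_R0 (fun k => INR (S k) * a (S k) * m (j - k)%nat) j.

Lemma exp_coefs_exists (a : nat -> R) : exists m, exp_coefs a m.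
Proof.
set (next := fun (f : nat -> R) j =>
  / INR (S j) * sum_f_R0 (fun k => INR (S k) * a (S k) * f (j - k)%nat) j).
(* Course-of-values recursion: [tab n] is correct up to index [n] and later tables do not change
   these entries, so the diagonal is the solution. *)
set (tab := fix tab n : nat -> R := match n with
  | O => fun _ => 1
  | S n' => fun j => if Nat.eqb j n then next (tab n') n' else tab n' j
  end).
assert (forall d n, tab (n + d)%nat n = tab n n) as H.
{ intros d n; induction d as [|d IH]; [rewrite Nat.add_0_r; reflexivity|].
  rewrite <- IH, Nat.add_succ_r; simpl tab.
  destruct (Nat.eqb_spec n (S (n + d))); [lia|reflexivity]. }
exists (fun n => tab n n); split; [reflexivity|].
intros j; simpl tab; rewrite Nat.eqb_refl; unfold next.
rewrite <- Rmult_assoc, Rinv_r, Rmult_1_l by (apply not_0_INR; lia).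
apply sum_eq; intros k Hk; f_equal.
rewrite <- (H k (j - k)%nat); f_equal; lia.
Qed.

Lemma exp_coefs_local (a b m m' : nat -> R) (M : nat) :
  exp_coefs a m -> exp_coefs b m' ->
  (forall j, (j <= M)%nat -> a j = b j) ->
  forall j, (j <= M)%nat -> m j = m' j.
Proof.
intros [Hm0 Hm] [Hm0' Hm'] Hab j.
induction j as [[|j] IH] using (well_founded_induction lt_wf); intros Hj.
- rewrite Hm0, Hm0'; reflexivity.
- apply (Rmult_eq_reg_l (INR (S j))); [|apply not_0_INR; lia].
  rewrite Hm, Hm'.
  apply sum_eq; intros k Hk.
  rewrite Hab, IH by lia; reflexivity.
Qed.

(** The bound [|m j| <= (1 + A) ^ j] reproduces itself, because [A] times the geometric sum of ratio
    [1 + A] up to [j] is at most [(1 + A) ^ S j]. *)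
Lemma exp_coefs_CV_radius (a m : nat -> R) (A : R) :
  exp_coefs a m -> (forall k, Rabs (INR (S k) * a (S k)) <= A) ->
  Rbar_lt 0 (CV_radius m).
Proof.
intros [Hm0 Hm] HA.
assert (0 <= A) as HA0 by (eapply Rle_trans; [apply Rabs_pos|apply (HA 0%nat)]).
assert (forall j, Rabs (m j) <= (1 + A) ^ j) as Hb.
{ intros j; induction j as [[|j] IH] using (well_founded_induction lt_wf).
  - rewrite Hm0, Rabs_R1; simpl; lra.
  - assert (1 <= INR (S j)) as Hj by (rewrite S_INR; generalize (pos_INR j); lra).
    assert (Rabs (INR (S j) * m (S j)) <= (1 + A) ^ S j) as H.
    { rewrite Hm.
      eapply Rle_trans; [apply Rsum_abs|].
      apply Rle_trans with (A * sum_f_R0 (fun k => (1 + A) ^ k) j).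
      - rewrite (sum_f_R0_rev (fun k => (1 + A) ^ k)), scal_sum.
        apply sum_Rle; intros k Hk.
        rewrite Rabs_mult, (Rmult_comm (_ ^ _)).
        apply Rmult_le_compat; try apply Rabs_pos; trivial.
        apply IH; lia.
      - clear - HA0; induction j as [|j IH]; [simpl; lra|].
        rewrite tech5.
        change ((1 + A) ^ S (S j)) with ((1 + A) * (1 + A) ^ S j); lra. }
    rewrite Rabs_mult, (Rabs_pos_eq (INR (S j))) in H by lra.
    generalize (Rabs_pos (m (S j))); nra. }
apply (CV_radius_pos m (/ (1 + A)) 1); [apply Rinv_0_lt_compat; lra|].
intros n; rewrite Rabs_mult, <- RPow_abs, Rabs_inv, (Rabs_pos_eq (1 + A)), pow_inv by lra.
assert (0 < (1 + A) ^ n) by (apply pow_lt; lra).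
apply (Rmult_le_reg_r ((1 + A) ^ n)); trivial.
rewrite Rmult_assoc, Rinv_l by lra.
generalize (Hb n); lra.
Qed.

Lemma constant_ball (f : R -> R) (r : R) :
  (forall x, Rabs x < r -> is_derive f x 0) ->
  forall x, Rabs x < r -> f x = f 0.
Proof.
intros H x Hx.
destruct (Rtotal_order x 0) as [Hlt|[E|Hgt]].
- apply eq_is_derive; trivial.
  intros t Ht; apply H; revert Hx; unfold Rabs; repeat destruct Rcase_abs; lra.
- rewrite E; reflexivity.
- symmetry; apply eq_is_derive; trivial.
  intros t Ht; apply H; revert Hx; unfold Rabs; repeat destruct Rcase_abs; lra.
Qed.

(** The equation [m' = a' m] says that [m exp (- a)] has derivative 0; its value at 0 is 1. *)
Lemma PSeries_exp_coefs (a m : nat -> R) :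
  Rbar_lt 0 (CV_radius a) -> Rbar_lt 0 (CV_radius m) -> a 0%nat = 0 ->
  exp_coefs a m ->
  exists r, 0 < r /\ forall x, Rabs x < r -> PSeries m x = exp (PSeries a x).
Proof.
intros Ha Hm Ha0 [Hm0 Hrec].
destruct (CV_radius_pos_ball a Ha) as [r1 [Hr1 Hball1]].
destruct (CV_radius_pos_ball m Hm) as [r2 [Hr2 Hball2]].
exists (Rmin r1 r2); split; [apply Rmin_pos; trivial|].
assert (forall x, Rabs x < Rmin r1 r2 ->
  PSeries m x * exp (- PSeries a x) = PSeries m 0 * exp (- PSeries a 0)) as H.
{ apply (constant_ball (fun x => PSeries m x * exp (- PSeries a x))).
  intros x Hx.
  assert (Rbar_lt (Rabs x) (CV_radius a)) as Hxa
    by (apply Hball1; eapply Rlt_le_trans; [exact Hx|apply Rmin_l]).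
  assert (Rbar_lt (Rabs x) (CV_radius m)) as Hxm
    by (apply Hball2; eapply Rlt_le_trans; [exact Hx|apply Rmin_r]).
  assert (PSeries (PS_derive m) x = PSeries (PS_derive a) x * PSeries m x) as E.
  { rewrite <- PSeries_mult; trivial.
    - apply PSeries_ext; intros n; apply Hrec.
    - rewrite CV_radius_derive; exact Hxa. }
  generalize (is_derive_PSeries a x Hxa) (is_derive_PSeries m x Hxm).
  rewrite E; intros Da Dm.
  replace 0 with (PSeries (PS_derive a) x * PSeries m x * exp (- PSeries a x)
    + PSeries m x * (- PSeries (PS_derive a) x * exp (- PSeries a x))) by ring.
  apply (is_derive_mult (PSeries m) (fun x => exp (- PSeries a x)));
    [exact Dm| |intros; apply Rmult_comm].
  apply (is_derive_comp exp (fun x => - PSeries a x)).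
  - apply is_derive_exp.
  - apply (is_derive_opp (PSeries a)); exact Da. }
intros x Hx.
specialize (H x Hx).
rewrite 2!PSeries_0, Hm0, Ha0, Ropp_0, exp_0, exp_Ropp in H.
generalize (exp_pos (PSeries a x)); intros Hp.
replace (PSeries m x) with
  (PSeries m x * / exp (PSeries a x) * exp (PSeries a x)) by (field; lra).
rewrite H; ring.
Qed.

Lemma exp_sub_1_bound (d : R) : Rabs d <= / 2 -> Rabs (exp d - 1) <= 2 * Rabs d.
Proof.
intros H.
generalize (exp_ineq1_le d) (exp_ineq1_le (- d)); intros H1 H2.
rewrite exp_Ropp in H2.
generalize (exp_pos d); intros Hp.
assert (/ exp d * exp d = 1) as E by (apply Rinv_l; lra).
apply Rabs_le_between in H.
assert (exp d * (1 - d) <= 1) by nra.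
unfold Rabs; repeat destruct Rcase_abs; nra.
Qed.

(** The series [a] may diverge. It is replaced by the polynomial [b] of its terms up to degree [M],
    whose exponential [p] is a convergent series; by [exp_coefs_local] the coefficients of [p] and
    [m] agree up to degree [M]. *)
Lemma expands_exp (e a m F : nat -> R) :
  is_lim_seq e 0 -> a 0%nat = 0 -> exp_coefs a m ->
  expands e a F -> expands e m (fun n => exp (F n)).
Proof.
intros He Ha0 Hm HF M.
set (b := fun j => if Nat.leb j M then a j else 0).
assert (forall j, (j <= M)%nat -> a j = b j) as Hab.
{ intros j Hj; unfold b; apply Nat.leb_le in Hj; rewrite Hj; reflexivity. }
assert (forall (u : nat -> R), exists A, forall j, Rabs (u j * b j) <= A) as Hbd.
{ intros u.
  exists (sum_f_R0 (fun j => Rabs (u j * b j)) M); intros j.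
  destruct (le_lt_dec j M) as [Hj|Hj].
  - apply (Rabs_le_sum (fun j => u j * b j)); exact Hj.
  - unfold b at 1; apply Nat.leb_gt in Hj; rewrite Hj, Rmult_0_r, Rabs_R0.
    apply cond_pos_sum; intros; apply Rabs_pos. }
destruct (exp_coefs_exists b) as [p Hp].
assert (Rbar_lt 0 (CV_radius b)) as Hcb.
{ destruct (Hbd (fun _ => 1)) as [A HA].
  apply (CV_radius_pos b 1 A); [lra|].
  intros n; rewrite pow1, Rmult_comm; apply HA. }
assert (Rbar_lt 0 (CV_radius p)) as Hcp.
{ destruct (Hbd INR) as [A HA].
  apply (exp_coefs_CV_radius b p A Hp); intros k; apply HA. }
destruct (PSeries_exp_coefs b p Hcb Hcp) as [r [Hr HE]];
  [exact Ha0|exact Hp|].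
destruct (HF M) as [K HK].
destruct (expands_PSeries e b He Hcb M) as [L HL].
destruct (expands_PSeries e p He Hcp M) as [J HJ].
destruct (expands_PSeries e p He Hcp 0%nat) as [I HI].
set (D := Rabs K + Rabs L).
set (U := Rabs I + 1).
exists (2 * D * U + J).
assert (0 <= D) as HD by (unfold D; generalize (Rabs_pos K) (Rabs_pos L); lra).
(* The last threshold makes [D q <= 1 / 2], as [exp_sub_1_bound] requires. *)
assert (eventually (fun n => Rabs (e n) < Rmin 1 (Rmin r (/ (2 * (D + 1)))))) as H1.
{ apply is_lim_seq_0_eventually_lt; trivial.
  repeat apply Rmin_pos; try lra; apply Rinv_0_lt_compat; lra. }
generalize (filter_and _ _ H1 (filter_and _ _ HK (filter_and _ _ HL
  (filter_and _ _ HJ HI)))).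
apply filter_imp; intros n [Hn [HKn [HLn [HJn HIn]]]].
set (x := e n) in *.
assert (Rabs x < 1) as Hx1 by (eapply Rlt_le_trans; [exact Hn|apply Rmin_l]).
assert (Rabs x < r) as Hxr by (eapply Rlt_le_trans;
  [exact Hn|eapply Rle_trans; [apply Rmin_r|apply Rmin_l]]).
assert (Rabs x < / (2 * (D + 1))) as HxD by (eapply Rlt_le_trans;
  [exact Hn|eapply Rle_trans; [apply Rmin_r|apply Rmin_r]]).
assert (0 <= Rabs x) as Hx0 by apply Rabs_pos.
assert (0 <= Rabs x ^ S M <= Rabs x) as [Hq0 Hq1].
{ split; [apply pow_le; trivial|].
  simpl; rewrite <- (Rmult_1_r (Rabs x)) at 3.
  apply Rmult_le_compat_l; trivial.
  rewrite <- (pow1 M); apply pow_incr; lra. }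
set (q := Rabs x ^ S M) in *.
(* Since [d] is of order [M + 1], so is the relative error [exp d - 1] made by passing to the
   polynomial. *)
set (d := F n - PSeries b x).
assert (Rabs d <= D * q) as Hd.
{ unfold d, D.
  rewrite (sum_eq (fun j => a j * x ^ j) (fun j => b j * x ^ j)) in HKn
    by (intros; rewrite Hab; trivial).
  replace (F n - PSeries b x) with
    ((F n - sum_f_R0 (fun j => b j * x ^ j) M)
     - (PSeries b x - sum_f_R0 (fun j => b j * x ^ j) M)) by ring.
  eapply Rle_trans; [apply Rabs_triang|].
  rewrite Rabs_Ropp.
  generalize (Rle_abs K) (Rle_abs L); nra. }
assert (Rabs (exp d - 1) <= 2 * (D * q)) as Hed.
{ eapply Rle_trans; [apply exp_sub_1_bound|lra].
  assert (/ (2 * (D + 1)) * (2 * (D + 1)) = 1) as E by (apply Rinv_l; lra).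
  nra. }
assert (Rabs (PSeries p x) <= U) as HU.
{ unfold U.
  simpl in HIn; rewrite (proj1 Hp) in HIn.
  replace (PSeries p x) with ((PSeries p x - 1 * 1) + 1) by ring.
  eapply Rle_trans; [apply Rabs_triang|].
  rewrite Rabs_R1.
  generalize (Rle_abs I) (Rabs_pos I); nra. }
rewrite (sum_eq _ (fun j => p j * x ^ j))
  by (intros i Hi; rewrite (exp_coefs_local a b m p M); trivial).
replace (exp (F n)) with (PSeries p x * exp d).
2:{ rewrite HE, <- exp_plus by trivial; f_equal; unfold d; ring. }
replace (_ - _) with (PSeries p x * (exp d - 1)
  + (PSeries p x - sum_f_R0 (fun j => p j * x ^ j) M)) by ring.
eapply Rle_trans; [apply Rabs_triang|].
rewrite Rabs_mult.
assert (Rabs (PSeries p x) * Rabs (exp d - 1) <= U * (2 * (D * q)))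
  by (apply Rmult_le_compat; trivial; apply Rabs_pos).
lra.
Qed.

(** * The generating function of the Bernoulli numbers *)

Definition taylor (a : nat -> R) (f : R -> R) : Prop :=
  exists r, 0 < r /\ forall x, Rabs x < r -> is_pseries a x (f x).

Lemma ex_pseries_CV_radius (a : nat -> R) (x : R) :
  ex_pseries a x -> Rbar_le (Rabs x) (CV_radius a).
Proof.
intros H; apply Rbar_not_lt_le; intros Hlt.
apply (CV_disk_outside _ _ Hlt).
apply ex_series_lim_0, ex_pseries_R, H.
Qed.

Lemma taylor_CV_radius (a : nat -> R) (f : R -> R) :
  taylor a f -> Rbar_lt 0 (CV_radius a).
Proof.
intros [r [Hr H]].
apply Rbar_lt_le_trans with (Rabs (r / 2)).
- simpl; apply Rabs_pos_lt; lra.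
- apply ex_pseries_CV_radius; exists (f (r / 2)).
  apply H; rewrite Rabs_pos_eq; lra.
Qed.

Lemma taylor_PSeries (a : nat -> R) :
  Rbar_lt 0 (CV_radius a) -> taylor a (PSeries a).
Proof.
intros H; destruct (CV_radius_pos_ball a H) as [r [Hr Hb]].
exists r; split; trivial.
intros x Hx; apply PSeries_correct, CV_radius_inside, Hb, Hx.
Qed.

Lemma taylor_ext (a b : nat -> R) (f g : R -> R) (r : R) :
  (forall n, a n = b n) -> 0 < r -> (forall x, Rabs x < r -> f x = g x) ->
  taylor a f -> taylor b g.
Proof.
intros Hab Hr Hfg [r' [Hr' H]].
exists (Rmin r r'); split; [apply Rmin_pos; trivial|].
intros x Hx.
rewrite <- Hfg by (eapply Rlt_le_trans; [exact Hx|apply Rmin_l]).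
apply is_pseries_ext with a; trivial.
apply H; eapply Rlt_le_trans; [exact Hx|apply Rmin_r].
Qed.

(** Through this lemma each functional equation of [tau] becomes an identity between its
    coefficients. *)
Lemma taylor_unique (a b : nat -> R) (f : R -> R) :
  taylor a f -> taylor b f -> forall n, a n = b n.
Proof.
intros Ha Hb n.
apply PSeries_ext_recip.
- exact (taylor_CV_radius a f Ha).
- exact (taylor_CV_radius b f Hb).
- destruct Ha as [r [Hr Ha]]; destruct Hb as [r' [Hr' Hb]].
  exists (mkposreal _ (Rmin_pos _ _ Hr Hr')); intros x Hx.
  assert (Rabs x < Rmin r r') as Hx'
    by (rewrite <- (Rminus_0_r x); exact Hx).
  rewrite (is_pseries_unique a x (f x)), (is_pseries_unique b x (f x)); trivial.
  + apply Hb; eapply Rlt_le_trans; [exact Hx'|apply Rmin_r].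
  + apply Ha; eapply Rlt_le_trans; [exact Hx'|apply Rmin_l].
Qed.

Lemma taylor_scal (a : nat -> R) (f : R -> R) (c : R) :
  taylor a f -> taylor (fun n => c * a n) (fun x => c * f x).
Proof.
intros [r [Hr H]]; exists r; split; trivial.
intros x Hx; apply (is_pseries_scal c a); [exact (Rmult_comm x c)|apply H, Hx].
Qed.

Lemma taylor_lin (a b : nat -> R) (f g : R -> R) (c : R) :
  taylor a f -> taylor b g ->
  taylor (fun n => a n + c * b n) (fun x => f x + c * g x).
Proof.
intros [r [Hr Ha]] [r' [Hr' Hb]].
exists (Rmin r r'); split; [apply Rmin_pos; trivial|].
intros x Hx.
apply (is_pseries_plus a (PS_scal c b)).
- apply Ha; eapply Rlt_le_trans; [exact Hx|apply Rmin_l].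
- apply (is_pseries_scal c b); [exact (Rmult_comm x c)|].
  apply Hb; eapply Rlt_le_trans; [exact Hx|apply Rmin_r].
Qed.

Lemma taylor_mult (a b : nat -> R) (f g : R -> R) :
  taylor a f -> taylor b g -> taylor (PS_mult a b) (fun x => f x * g x).
Proof.
intros Ha Hb.
destruct (CV_radius_pos_ball a (taylor_CV_radius a f Ha)) as [s [Hs Hsa]].
destruct (CV_radius_pos_ball b (taylor_CV_radius b g Hb)) as [s' [Hs' Hsb]].
destruct Ha as [r [Hr Ha]]; destruct Hb as [r' [Hr' Hb]].
exists (Rmin (Rmin r s) (Rmin r' s')); split; [repeat apply Rmin_pos; trivial|].
intros x Hx.
generalize (Rmin_l (Rmin r s) (Rmin r' s')) (Rmin_r (Rmin r s) (Rmin r' s'))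
  (Rmin_l r s) (Rmin_r r s) (Rmin_l r' s') (Rmin_r r' s'); intros.
apply is_pseries_mult; [apply Ha|apply Hb|apply Hsa|apply Hsb]; lra.
Qed.

Lemma taylor_dilate (a : nat -> R) (f : R -> R) (c : R) : 0 < c <= 1 ->
  taylor a f -> taylor (fun n => c ^ n * a n) (fun x => f (c * x)).
Proof.
intros Hc [r [Hr H]]; exists r; split; trivial.
intros x Hx; apply is_pseries_R.
apply is_series_ext with (fun n => a n * (c * x) ^ n).
- intros n; change (a n * (c * x) ^ n = c ^ n * a n * x ^ n).
  rewrite Rpow_mult_distr; ring.
- apply is_pseries_R, H.
  rewrite Rabs_mult, (Rabs_pos_eq c) by lra.
  generalize (Rabs_pos x); nra.
Qed.

Lemma taylor_derive (a : nat -> R) (f f' : R -> R) :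
  taylor a f -> (forall x, is_derive f x (f' x)) -> taylor (PS_derive a) f'.
Proof.
intros Ha Hf.
destruct (CV_radius_pos_ball a (taylor_CV_radius a f Ha)) as [s [Hs Hsa]].
destruct Ha as [r [Hr Ha]].
exists (Rmin r s); split; [apply Rmin_pos; trivial|].
intros x Hx.
assert (Rabs x < r) as Hxr by (eapply Rlt_le_trans; [exact Hx|apply Rmin_l]).
replace (f' x) with (Derive (PSeries a) x).
- apply is_pseries_derive, Hsa.
  eapply Rlt_le_trans; [exact Hx|apply Rmin_r].
- rewrite <- (is_derive_unique _ _ _ (Hf x)).
  apply Derive_ext_loc.
  assert (0 < r - Rabs x) as Hd by lra.
  exists (mkposreal _ Hd); intros y Hy.
  apply is_pseries_unique, Ha.
  assert (Rabs (y - x) < r - Rabs x) as Hy' by exact Hy.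
  replace y with ((y - x) + x) by ring.
  generalize (Rabs_triang (y - x) x); lra.
Qed.

Definition monomial (i n : nat) : R := if Nat.eqb n i then 1 else 0.

Definition expc (s : R) (n : nat) : R := s ^ n / INR (fact n).

Lemma taylor_monomial (i : nat) : taylor (monomial i) (fun x => x ^ i).
Proof.
exists 1; split; [lra|]; intros x _.
induction i as [|i IH].
- apply is_pseries_R.
  change (is_lim_seq (sum_n (fun n => monomial 0 n * x ^ n)) 1).
  apply is_lim_seq_ext with (fun _ => 1); [|apply is_lim_seq_const].
  intros n; symmetry; induction n as [|n IH].
  + rewrite sum_O; unfold monomial; simpl; ring.
  + rewrite sum_Sn, IH; unfold monomial, plus; simpl; ring.
- apply is_pseries_ext with (PS_incr_1 (monomial i)).
  + intros [|n]; reflexivity.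
  + apply (is_pseries_incr_1 (monomial i)), IH.
Qed.

Lemma taylor_expc (s : R) : taylor (expc s) (fun x => exp (s * x)).
Proof.
exists 1; split; [lra|]; intros x _.
apply is_pseries_R.
apply is_series_ext with (fun n => / INR (fact n) * (s * x) ^ n).
- intros n; change (/ INR (fact n) * (s * x) ^ n = s ^ n * / INR (fact n) * x ^ n).
  rewrite Rpow_mult_distr; ring.
- apply is_pseries_R, is_exp_Reals.
Qed.

Lemma PS_mult_lin_r (a b d : nat -> R) (c : R) (n : nat) :
  PS_mult a (fun k => b k + c * d k) n = PS_mult a b n + c * PS_mult a d n.
Proof.
unfold PS_mult; rewrite scal_sum, <- plus_sum.
apply sum_eq; intros k _; ring.
Qed.

Lemma PS_mult_monomial_0_r (a : nat -> R) (n : nat) :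
  PS_mult a (monomial 0) n = a n.
Proof.
unfold PS_mult; destruct n as [|n]; [unfold monomial; simpl; ring|].
rewrite tech5, sum_f_R0_0.
- rewrite Nat.sub_diag; unfold monomial; simpl; ring.
- intros i Hi; unfold monomial.
  destruct (Nat.eqb_spec (S n - i) 0); [lia|ring].
Qed.

(** [tau x = - tanh (x / 4)] *)
Definition tau (x : R) : R := (1 - exp (x / 2)) / (1 + exp (x / 2)).

(** With [b(x) = x / (exp x - 1)] one has [x tau(x) = 4 b(x / 2) - 4 b(x) - x]; cancelling [x]
    shifts the index of the Bernoulli numbers by one. *)
Definition tauc (B : nat -> R) (n : nat) : R :=
  (2 * (1 / 2) ^ n - 4) * (B (S n) / INR (fact (S n))) - monomial 0 n.

Lemma taylor_tauc (B : nat -> R) : is_bernoulli B -> taylor (tauc B) tau.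
Proof.
intros [r [Hr HB]].
set (b := fun n => B n / INR (fact n)) in *.
assert (Rbar_lt 0 (CV_radius b)) as Hb.
{ apply Rbar_lt_le_trans with (Rabs (r / 2)).
  - simpl; apply Rabs_pos_lt; lra.
  - apply ex_pseries_CV_radius; eexists.
    apply HB; rewrite Rabs_pos_eq; lra. }
generalize (taylor_PSeries b Hb); intros Tb.
assert (forall x, 0 < Rabs x < r -> PSeries b x = x / (exp x - 1)) as Eb
  by (intros x Hx; apply is_pseries_unique, HB, Hx).
assert (forall x, x <> 0 -> exp x - 1 <> 0) as Hexp.
{ intros x Hx E; apply Hx, exp_inv; rewrite exp_0; lra. }
(* This value settles the point 0, where [x tau(x)] says nothing about [tau]. It comes from
   comparing coefficients in [b(x) (exp x - 1) = x]. *)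
assert (b 1%nat = - (1 / 2)) as Hb1.
{ assert (forall n, PS_mult b (fun k => expc 1 k + (-1) * monomial 0 k) n
    = monomial 1 n) as E.
  { apply taylor_unique with (fun x => x ^ 1); [|apply taylor_monomial].
    apply (taylor_ext _ _ (fun x => PSeries b x * (exp (1 * x) + (-1) * x ^ 0))
      (fun x => x ^ 1) r (fun n => eq_refl) Hr).
    - intros x Hx.
      destruct (Req_dec x 0) as [->|Hx0].
      + rewrite Rmult_0_r, exp_0; simpl; ring.
      + rewrite Eb by (split; [apply Rabs_pos_lt|]; trivial).
        rewrite Rmult_1_l; simpl; field; apply Hexp, Hx0.
    - apply taylor_mult; trivial.
      apply taylor_lin; [apply taylor_expc|apply taylor_monomial]. }
  generalize (E 1%nat) (E 2%nat); unfold PS_mult, expc, monomial; simpl; lra. }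
assert (taylor (PS_incr_1 (tauc B)) (fun x => x * tau x)) as T.
{ apply (taylor_ext
    (fun n => (4 * ((1 / 2) ^ n * b n) - 4 * b n) - monomial 1 n) _
    (fun x => (4 * PSeries b (1 / 2 * x) - 4 * PSeries b x) - x) _ r); trivial.
  - intros [|n]; [change (4 * (1 * b 0%nat) - 4 * b 0%nat - 0 = 0); ring|].
    change (PS_incr_1 (tauc B) (S n)) with
      ((2 * (1 / 2) ^ n - 4) * b (S n) - monomial 1 (S n)).
    simpl pow; field.
  - intros x Hx.
    destruct (Req_dec x 0) as [->|Hx0]; [rewrite Rmult_0_r; ring|].
    assert (0 < Rabs x) as Hx1 by (apply Rabs_pos_lt, Hx0).
    rewrite 2!Eb; [|split; trivial|
      rewrite Rabs_mult, (Rabs_pos_eq (1 / 2)); lra].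
    unfold tau.
    replace (1 / 2 * x) with (x / 2) by field.
    replace (exp x) with (exp (x / 2) * exp (x / 2))
      by (rewrite <- exp_plus; f_equal; field).
    generalize (exp_pos (x / 2)) (Hexp (x / 2)); intros Hp Hn.
    assert (exp (x / 2) - 1 <> 0) as Hn' by (apply Hn; lra).
    field; repeat split; try lra.
    replace (exp (x / 2) * exp (x / 2) - 1) with
      ((exp (x / 2) - 1) * (exp (x / 2) + 1)) by ring.
    apply Rmult_integral_contrapositive; split; lra.
  - apply (taylor_ext
      (fun n => 4 * ((1 / 2) ^ n * b n) + (-4) * b n + (-1) * monomial 1 n) _
      (fun x => 4 * PSeries b (1 / 2 * x) + (-4) * PSeries b x + (-1) * x ^ 1)
      _ 1); [intros; ring|lra|intros; simpl; ring|].
    apply taylor_lin; [|apply taylor_monomial].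
    apply taylor_lin; trivial.
    apply (taylor_scal (fun n => (1 / 2) ^ n * b n)
      (fun x => PSeries b (1 / 2 * x))).
    apply taylor_dilate; trivial; lra. }
assert (Rbar_lt 0 (CV_radius (tauc B))) as Hc.
{ generalize (taylor_CV_radius _ _ T); rewrite CV_radius_incr_1; trivial. }
destruct T as [r' [Hr' T]].
apply (taylor_ext (tauc B) _ (PSeries (tauc B)) _ r'
  (fun n => eq_refl) Hr'); [|apply taylor_PSeries, Hc].
intros x Hx.
destruct (Req_dec x 0) as [->|Hx0].
- rewrite PSeries_0; unfold tauc, tau.
  change (B 1%nat / INR (fact 1)) with (b 1%nat).
  rewrite Hb1; replace (0 / 2) with 0 by field; rewrite exp_0.
  unfold monomial; simpl; field.
- apply (Rmult_eq_reg_l x); trivial.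
  rewrite <- PSeries_incr_1.
  apply is_pseries_unique, T, Hx.
Qed.

Lemma one_plus_exp_neq_0 (x : R) : 1 + exp x <> 0.
Proof. generalize (exp_pos x); lra. Qed.

Lemma tau_exp_neg_half (x : R) :
  tau x * (exp (- (1 / 2) * x) + 1) = exp (- (1 / 2) * x) - 1.
Proof.
unfold tau.
replace (- (1 / 2) * x) with (- (x / 2)) by field.
rewrite exp_Ropp.
generalize (exp_pos (x / 2)); intros H.
field; lra.
Qed.

(** On the Borel side, multiplication by [exp (- x / 2)] is the passage from [n + 1 / 2] to [n];
    this identity produces the numbers [nu]. *)
Lemma tauc_half (B : nat -> R) (n : nat) : is_bernoulli B ->
  PS_mult (tauc B) (expc (- (1 / 2))) n
  = - tauc B n + expc (- (1 / 2)) n - monomial 0 n.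
Proof.
intros HB.
assert (PS_mult (tauc B) (fun k => expc (- (1 / 2)) k + 1 * monomial 0 k) n
  = expc (- (1 / 2)) n + (-1) * monomial 0 n) as E.
{ revert n; apply taylor_unique
    with (fun x => exp (- (1 / 2) * x) + (-1) * x ^ 0).
  - apply (taylor_ext _ _ (fun x => tau x * (exp (- (1 / 2) * x) + 1 * x ^ 0))
      _ 1 (fun n => eq_refl) Rlt_0_1).
    + intros x _; simpl; rewrite 2!Rmult_1_r, tau_exp_neg_half; ring.
    + apply taylor_mult; [apply taylor_tauc, HB|].
      apply taylor_lin; [apply taylor_expc|apply taylor_monomial].
  - apply taylor_lin; [apply taylor_expc|apply taylor_monomial]. }
rewrite PS_mult_lin_r, PS_mult_monomial_0_r in E; lra.
Qed.

(** Multiplication by [exp (- x)] is the step from [n] to [n + 1]. With [u = exp (- x / 2)], the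
    identity is [tau (u ^ 2 - 1) = (u - 1) ^ 2], the counterpart of [wallis_log_step]. *)
Lemma tauc_shift (B : nat -> R) (n : nat) : is_bernoulli B ->
  PS_mult (tauc B) (expc (-1)) n
  = tauc B n + expc (-1) n - 2 * expc (- (1 / 2)) n + monomial 0 n.
Proof.
intros HB.
assert (PS_mult (tauc B) (fun k => expc (-1) k + (-1) * monomial 0 k) n
  = expc (-1) n + (-2) * expc (- (1 / 2)) n + 1 * monomial 0 n) as E.
{ revert n; apply taylor_unique
    with (fun x => exp (-1 * x) + (-2) * exp (- (1 / 2) * x) + 1 * x ^ 0).
  - apply (taylor_ext _ _ (fun x => tau x * (exp (-1 * x) + (-1) * x ^ 0))
      _ 1 (fun n => eq_refl) Rlt_0_1).
    + intros x _; generalize (tau_exp_neg_half x).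
      replace (-1 * x) with (- (1 / 2) * x + - (1 / 2) * x) by field.
      rewrite exp_plus; set (u := exp (- (1 / 2) * x)); intros E.
      replace (u * u + -1 * x ^ 0) with ((u + 1) * (u - 1)) by (simpl; ring).
      rewrite <- Rmult_assoc, E; simpl; ring.
    + apply taylor_mult; [apply taylor_tauc, HB|].
      apply taylor_lin; [apply taylor_expc|apply taylor_monomial].
  - repeat apply taylor_lin; try apply taylor_expc; apply taylor_monomial. }
rewrite PS_mult_lin_r, PS_mult_monomial_0_r in E; lra.
Qed.

(** The equation [tanh' = 1 - tanh ^ 2], rescaled. It yields both the oddness of [tau] and the
    recurrence of the tangent coefficients. *)
Lemma tauc_riccati (B : nat -> R) (n : nat) : is_bernoulli B ->
  INR (S n) * tauc B (S n)
  = - (1 / 4) * (monomial 0 n - PS_mult (tauc B) (tauc B) n).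
Proof.
intros HB; revert n.
change (forall n, PS_derive (tauc B) n
  = - (1 / 4) * (monomial 0 n - PS_mult (tauc B) (tauc B) n)).
apply taylor_unique with (fun x => - (1 / 4) * (1 - tau x * tau x)).
- apply taylor_derive with tau; [apply taylor_tauc, HB|].
  intros x; unfold tau; auto_derive; [apply one_plus_exp_neq_0|].
  change (x * / 2) with (x / 2).
  field; apply one_plus_exp_neq_0.
- apply (taylor_ext
    (fun n => - (1 / 4) * monomial 0 n + 1 / 4 * PS_mult (tauc B) (tauc B) n) _
    (fun x => - (1 / 4) * x ^ 0 + 1 / 4 * (tau x * tau x)) _ 1);
    [intros; ring|lra|intros; simpl; ring|].
  apply taylor_lin; [|apply taylor_mult; apply taylor_tauc, HB].
  apply taylor_scal, taylor_monomial.
Qed.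

(** * The expansion of the logarithm *)

Lemma tauc_0 (B : nat -> R) : is_bernoulli B -> tauc B 0 = 0.
Proof.
intros HB; destruct (taylor_tauc B HB) as [r [Hr H]].
assert (PSeries (tauc B) 0 = tau 0) as E
  by (apply is_pseries_unique, H; rewrite Rabs_R0; exact Hr).
rewrite PSeries_0 in E; rewrite E; unfold tau.
replace (0 / 2) with 0 by field; rewrite exp_0; field.
Qed.

Definition lnc (c : R) (n : nat) : R :=
  match n with O => 0 | S i => c * (- c) ^ i / INR (S i) end.

(** The argument runs backwards: the polynomial [1 + c x] satisfies the equation characterizing the
    exponential of [lnc c]. Having degree 1, it leaves at most two terms of the convolution. *)
Lemma taylor_lnc (c : R) : 0 <= c <= 1 -> taylor (lnc c) (fun x => ln (1 + c * x)).
Proof.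
intros Hc.
set (m := fun n => monomial 0 n + c * monomial 1 n).
assert (taylor m (fun x => x ^ 0 + c * x ^ 1)) as Tm
  by (apply taylor_lin; apply taylor_monomial).
assert (Rbar_lt 0 (CV_radius (lnc c))) as Hr.
{ apply (CV_radius_pos (lnc c) 1 1); [lra|].
  intros n; rewrite pow1, Rmult_1_r; destruct n as [|i];
    [simpl; rewrite Rabs_R0; lra|].
  unfold lnc, Rdiv; rewrite 2!Rabs_mult, <- RPow_abs, Rabs_Ropp.
  rewrite (Rabs_pos_eq c), Rabs_pos_eq
    by (try (left; apply Rinv_0_lt_compat, lt_0_INR; lia); lra).
  assert (1 <= INR (S i)) as Hi by (rewrite S_INR; generalize (pos_INR i); lra).
  assert (/ INR (S i) <= 1)
    by (rewrite <- Rinv_1; apply Rinv_le_contravar; lra).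
  assert (c ^ S i <= 1) by (rewrite <- (pow1 (S i)); apply pow_incr; lra).
  assert (0 <= c ^ S i) by (apply pow_le; lra).
  assert (0 < / INR (S i)) by (apply Rinv_0_lt_compat; lra).
  simpl pow in *; nra. }
assert (exp_coefs (lnc c) m) as He.
{ split; [unfold m, monomial; simpl; ring|].
  intros j.
  rewrite (sum_eq _ (fun k => c * (- c) ^ k * m (j - k)%nat)).
  2:{ intros k _; unfold lnc; field; apply not_0_INR; lia. }
  destruct j as [|j]; [unfold m, monomial; simpl; ring|].
  rewrite tech5.
  assert (forall i, (2 <= i)%nat -> m i = 0) as Hm.
  { intros i Hi; unfold m, monomial.
    destruct (Nat.eqb_spec i 0), (Nat.eqb_spec i 1); try lia; ring. }
  rewrite Hm, Rmult_0_r by lia.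
  assert (sum_f_R0 (fun k => c * (- c) ^ k * m (S j - k)%nat) j
    = c * (- c) ^ j * c) as E.
  { destruct j as [|j]; [unfold m, monomial; simpl; ring|].
    rewrite tech5, sum_f_R0_0.
    - replace (S (S j) - S j)%nat with 1%nat by lia.
      unfold m, monomial; simpl; ring.
    - intros i Hi; rewrite Hm by lia; ring. }
  rewrite E, Nat.sub_diag; unfold m, monomial; simpl; ring. }
destruct (PSeries_exp_coefs (lnc c) m Hr) as [r [Hr0 H]];
  [exact (taylor_CV_radius _ _ Tm)|reflexivity|exact He|].
destruct Tm as [r' [Hr' Tm]].
apply (taylor_ext (lnc c) _ (PSeries (lnc c)) _ (Rmin r r') (fun n => eq_refl));
  [apply Rmin_pos; trivial| |apply taylor_PSeries, Hr].
intros x Hx.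
rewrite <- (ln_exp (PSeries (lnc c) x)), <- H
  by (eapply Rlt_le_trans; [exact Hx|apply Rmin_l]).
f_equal.
rewrite (is_pseries_unique _ _ _ (Tm x ltac:(eapply Rlt_le_trans;
  [exact Hx|apply Rmin_r]))); ring.
Qed.

Lemma expands_taylor (e a : nat -> R) (f : R -> R) :
  is_lim_seq e 0 -> taylor a f -> expands e a (fun n => f (e n)).
Proof.
intros He Ta.
destruct (Ta) as [r [Hr H]].
apply (expands_ext e a a (fun n => PSeries a (e n))); trivial.
- generalize (is_lim_seq_0_eventually_lt e r He Hr).
  apply filter_imp; intros n Hn; apply is_pseries_unique, H, Hn.
- apply expands_PSeries; trivial; exact (taylor_CV_radius a f Ta).
Qed.

(** The coefficients of [ln (W_n / (PI / 2))] in powers of [1 / (n + 1 / 2)]. *)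
Definition logc (B : nat -> R) (n : nat) : R :=
  match n with O => 0 | S j => INR (fact j) * tauc B (S j) end.

(** Translating the variable of an asymptotic series multiplies its Borel
    transform by an exponential. *)
Lemma logc_pw (B : nat -> R) (c : R) (j : nat) : is_bernoulli B ->
  sum_f_R0 (fun k => logc B k * pw c k (S j)) (S j)
  = INR (fact j) * PS_mult (tauc B) (expc (- c)) (S j).
Proof.
intros HB; unfold PS_mult; rewrite scal_sum; apply sum_eq; intros [|k] Hk.
- rewrite tauc_0 by trivial; simpl; ring.
- replace (S j) with (S k + (j - k))%nat at 1 by lia.
  rewrite pw_closed; unfold logc, expc.
  replace (k + (j - k))%nat with j by lia.
  replace (S j - S k)%nat with (j - k)%nat by lia.
  field; split; apply INR_fact_neq_0.
Qed.

(** Summing differences of order [M + 2] loses one power. No sum is formed: [w = u - 3 K e ^ S M] is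
    eventually increasing with limit 0, hence nonpositive. The constant 3 comes from
    [/ (1 + x) <= 1 - x / 3], valid for [0 <= x <= 2]. *)
Lemma telescoping_upper (e u : nat -> R) (K : R) (M : nat) :
  (forall n, 0 < e n <= 2) -> (forall n, e (S n) = e n / (1 + e n)) ->
  0 <= K -> is_lim_seq e 0 -> is_lim_seq u 0 ->
  eventually (fun n => - (K * e n ^ S (S M)) <= u (S n) - u n) ->
  eventually (fun n => u n <= 3 * K * e n ^ S M).
Proof.
intros He HeS HK Hl Hu [N HN].
exists N; intros n Hn.
set (w := fun n => u n - 3 * K * e n ^ S M).
assert (is_lim_seq (fun n => w (n + N)%nat) 0) as Hw.
{ apply (is_lim_seq_incr_n w).
  replace 0 with (0 - 3 * K * 0 ^ S M) by (simpl; ring).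
  apply is_lim_seq_minus'; trivial.
  apply is_lim_seq_mult'; [apply is_lim_seq_const|].
  apply (is_lim_seq_continuous (fun x => x ^ S M)); trivial.
  apply derivable_continuous_pt, derivable_pt_pow. }
assert (w n <= 0); [|unfold w in *; lra].
replace n with ((n - N) + N)%nat by lia.
apply (is_lim_seq_incr_compare (fun n => w (n + N)%nat) 0 Hw).
clear n Hn; intros n.
change (S n + N)%nat with (S (n + N)).
generalize (HN (n + N)%nat ltac:(lia)) (He (n + N)%nat) (HeS (n + N)%nat).
set (i := (n + N)%nat); set (x := e i); intros H1 H2 H3.
unfold w; rewrite H3; fold x.
assert ((x / (1 + x)) ^ S M <= x ^ S M * / (1 + x)) as H4.
{ simpl; unfold Rdiv; rewrite (Rmult_assoc x).
  replace (x * x ^ M * / (1 + x)) with (x * (/ (1 + x) * x ^ M)) by ring.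
  apply Rmult_le_compat_l; [lra|].
  assert (0 < / (1 + x)) by (apply Rinv_0_lt_compat; lra).
  apply Rmult_le_compat_l; [lra|].
  apply pow_incr; split; [apply Rmult_le_pos; lra|].
  assert (/ (1 + x) <= 1) by (rewrite <- Rinv_1; apply Rinv_le_contravar; lra).
  nra. }
assert (x ^ S M * / (1 + x) <= x ^ S M - / 3 * x ^ S (S M)) as H5.
{ assert (/ (1 + x) <= 1 - / 3 * x) as H6.
  { apply (Rmult_le_reg_r (1 + x)); [lra|].
    rewrite Rinv_l by lra; nra. }
  change (x ^ S (S M)) with (x * x ^ S M).
  assert (0 < x ^ S M) by (apply pow_lt; lra); nra. }
fold x in H1.
assert (3 * K * (x / (1 + x)) ^ S M <= 3 * K * (x ^ S M - / 3 * x ^ S (S M)))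
  by (apply Rmult_le_compat_l; lra).
lra.
Qed.

Lemma telescoping (e u : nat -> R) (K : R) (M : nat) :
  (forall n, 0 < e n <= 2) -> (forall n, e (S n) = e n / (1 + e n)) ->
  is_lim_seq e 0 -> is_lim_seq u 0 ->
  eventually (fun n => Rabs (u (S n) - u n) <= K * Rabs (e n) ^ S (S M)) ->
  eventually (fun n => Rabs (u n) <= 3 * Rabs K * Rabs (e n) ^ S M).
Proof.
intros He HeS Hl Hu H.
assert (eventually (fun n =>
  Rabs (u (S n) - u n) <= Rabs K * e n ^ S (S M))) as H'.
{ revert H; apply filter_imp; intros n Hn.
  rewrite (Rabs_pos_eq (e n)) in Hn by (generalize (He n); lra).
  eapply Rle_trans; [exact Hn|].
  apply Rmult_le_compat_r; [|apply Rle_abs].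
  apply pow_le; generalize (He n); lra. }
assert (eventually (fun n => u n <= 3 * Rabs K * e n ^ S M)) as Hup.
{ apply telescoping_upper; trivial; [apply Rabs_pos|].
  revert H'; apply filter_imp; intros n Hn; apply Rabs_le_between in Hn; lra. }
assert (eventually (fun n => - u n <= 3 * Rabs K * e n ^ S M)) as Hlo.
{ apply (telescoping_upper e (fun n => - u n)); trivial; [apply Rabs_pos| |].
  - replace (Finite 0) with (Rbar_opp 0) by (simpl; f_equal; ring).
    apply -> is_lim_seq_opp; exact Hu.
  - revert H'; apply filter_imp; intros n Hn; apply Rabs_le_between in Hn; lra. }
generalize (filter_and _ _ Hup Hlo); apply filter_imp; intros n [H1 H2].
rewrite (Rabs_pos_eq (e n)) by (generalize (He n); lra).
apply Rabs_le; lra.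
Qed.

(** The expansion of the logarithm is odd in [n + 1 / 2]. *)
Definition half_step (n : nat) : R := / (INR n + 1 / 2).

Lemma half_step_bounds (n : nat) : 0 < half_step n <= 2.
Proof.
unfold half_step; generalize (pos_INR n); intros H; split.
- apply Rinv_0_lt_compat; lra.
- replace 2 with (/ (1 / 2)) by field; apply Rinv_le_contravar; lra.
Qed.

Lemma half_step_S (n : nat) : half_step (S n) = half_step n / (1 + half_step n).
Proof.
unfold half_step; rewrite S_INR; generalize (pos_INR n); intros H.
field; lra.
Qed.

Lemma half_step_lim : is_lim_seq half_step 0.
Proof.
apply (is_lim_seq_inv (fun n => INR n + 1 / 2) p_infty); [|discriminate].
apply is_lim_seq_plus with p_infty (1 / 2);
  [apply is_lim_seq_INR|apply is_lim_seq_const|reflexivity].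
Qed.

(** With [x = n + 1 / 2] the new factor of the product is [(x + 1 / 2) ^ 2 / (x (x + 1))]. *)
Lemma wallis_log_step (n : nat) :
  ln (wallis (S n)) - ln (wallis n)
  = ln (1 + 1 / 2 * half_step n) * 2 - ln (1 + 1 * half_step n).
Proof.
generalize (wallis_pos n) (half_step_bounds n); intros Hw He.
assert (0 <= INR n) as Hn by apply pos_INR.
assert (0 < 1 + 1 / 2 * half_step n) as H1 by lra.
assert (0 < 1 + 1 * half_step n) as H2 by lra.
assert (4 * INR (S n) ^ 2 / (4 * INR (S n) ^ 2 - 1) * (1 + 1 * half_step n)
  = (1 + 1 / 2 * half_step n) * (1 + 1 / 2 * half_step n)) as E.
{ unfold half_step; rewrite S_INR; field.
  split; [lra|].
  assert (0 <= INR n * INR n) by (apply Rmult_le_pos; trivial); nra. }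
assert (0 < 4 * INR (S n) ^ 2 / (4 * INR (S n) ^ 2 - 1)) as H3.
{ apply (Rmult_lt_reg_r (1 + 1 * half_step n)); trivial.
  rewrite E, Rmult_0_l; apply Rmult_lt_0_compat; trivial. }
cbn [wallis]; rewrite ln_mult by trivial.
apply (f_equal ln) in E.
rewrite 2!ln_mult in E by trivial.
lra.
Qed.

Lemma expands_log_wallis (B : nat -> R) : is_bernoulli B ->
  expands half_step (logc B) (fun n => ln (wallis n / (PI / 2))).
Proof.
intros HB M.
generalize half_step_bounds half_step_S half_step_lim.
set (e := half_step); intros Hb HS Hl.
set (P := fun x => sum_f_R0 (fun j => logc B j * x ^ j) M).
set (u := fun n => ln (wallis n / (PI / 2)) - P (e n)).
(* Differences determine [u] only up to a constant; Wallis' limit fixes it. *)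
assert (is_lim_seq u 0) as Hu.
{ replace (Finite 0) with (Finite (ln (PI / 2 / (PI / 2)) - P 0)).
  2:{ f_equal; generalize PI_RGT_0; intros Hpi.
      replace (PI / 2 / (PI / 2)) with 1 by (field; lra).
      rewrite ln_1; unfold P.
      rewrite sum_f_R0_0; [ring|].
      intros [|i] _; simpl; ring. }
  apply is_lim_seq_minus'.
  - assert (0 < PI / 2) as Hpi by (generalize PI_RGT_0; lra).
    apply (is_lim_seq_continuous ln (fun n => wallis n / (PI / 2))).
    + apply derivable_continuous_pt; eexists; apply derivable_pt_lim_ln.
      apply Rdiv_lt_0_compat; trivial.
    + apply is_lim_seq_div'; [apply wallis_lim|apply is_lim_seq_const|lra].
  - apply (is_lim_seq_continuous P e); trivial.
    apply derivable_continuous_pt, derivable_pt_finite_sum. }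
assert (expands e (fun j => 2 * lnc (1 / 2) j + (-1) * lnc 1 j
    + (-1) * sum_f_R0 (fun k => logc B k * pw 1 k j) M)
  (fun n => 2 * ln (1 + 1 / 2 * e n) + (-1) * ln (1 + 1 * e n)
    + (-1) * P (e (S n)))) as X.
{ apply expands_lin.
  - apply (expands_taylor e _ (fun x => 2 * ln (1 + 1 / 2 * x)
      + (-1) * ln (1 + 1 * x))); trivial.
    apply (taylor_lin _ _ (fun x => 2 * ln (1 + 1 / 2 * x)));
      [apply (taylor_scal _ (fun x => ln (1 + 1 / 2 * x)))|];
      apply taylor_lnc; lra.
  - apply (expands_ext e (fun j => sum_f_R0 (fun k => logc B k * pw 1 k j) M) _
      (fun n => sum_f_R0 (fun k => logc B k * (e n / (1 + 1 * e n)) ^ k) M));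
      [reflexivity| |].
    + exists 0%nat; intros n _; unfold P.
      rewrite HS, Rmult_1_l; reflexivity.
    + apply (expands_sum e (pw 1) (fun k n => (e n / (1 + 1 * e n)) ^ k)).
      intros k; apply expands_pw; trivial. }
(* One order more than the target, because telescoping loses one power. *)
destruct (X (S M)) as [K HK].
exists (3 * Rabs K).
apply (telescoping e u K M Hb HS Hl Hu).
revert HK; apply filter_imp; intros n Hn.
replace (u (S n) - u n) with (2 * ln (1 + 1 / 2 * e n)
  + (-1) * ln (1 + 1 * e n) + (-1) * P (e (S n)) + P (e n)).
2:{ generalize (wallis_log_step n); fold e.
    unfold u; rewrite 2!(ln_div _ (PI / 2))
      by (try apply wallis_pos; generalize PI_RGT_0; lra).
    lra. }
replace (P (e n)) with (- sum_f_R0 (fun j => (2 * lnc (1 / 2) j + -1 * lnc 1 j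
  + -1 * sum_f_R0 (fun k => logc B k * pw 1 k j) M) * e n ^ j) (S M));
  [exact Hn|].
assert (forall j, 2 * lnc (1 / 2) j + -1 * lnc 1 j
  = sum_f_R0 (fun k => logc B k * pw 1 k j) j - logc B j) as E.
{ intros [|j]; [simpl; ring|].
  rewrite logc_pw, tauc_shift by trivial.
  unfold logc, lnc, expc, monomial.
  rewrite fact_simpl, mult_INR.
  assert (INR (fact j) <> 0) by apply INR_fact_neq_0.
  assert (INR (S j) <> 0) by (apply not_0_INR; lia).
  replace (Ropp 1) with (-1) by ring.
  cbn [Nat.eqb pow].
  set (a := (-1) ^ j); set (b := (- (1 / 2)) ^ j); field; split; trivial. }
rewrite tech5.
(* In degree [S M] the sum truncated at [M] lacks only its diagonal term [logc B (S M)], which is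
   exactly what [E] subtracts. *)
replace (2 * lnc (1 / 2) (S M) + _ + _) with 0.
2:{ rewrite E, tech5.
    rewrite pw_diag; ring. }
rewrite (sum_eq _ (fun j => logc B j * e n ^ j * (-1))).
- rewrite <- scal_sum; fold (P (e n)); ring.
- intros j Hj; rewrite E.
  replace (sum_f_R0 (fun k => logc B k * pw 1 k j) M) with
    (sum_f_R0 (fun k => logc B k * pw 1 k j) j); [ring|].
  clear - Hj; induction Hj as [|M Hj IH]; [reflexivity|].
  rewrite tech5, <- IH, pw_lt by lia; ring.
Qed.

(** * Bounds on the coefficients of the tangent and of the exponential *)

Lemma fact_mult_le (a b : nat) :
  INR (fact a) * INR (fact b) <= INR (fact (a + b)).
Proof.
rewrite <- mult_INR; apply le_INR.
induction b as [|b IH].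
- rewrite Nat.add_0_r; simpl; lia.
- rewrite Nat.add_succ_r, 2!fact_simpl; nia.
Qed.

(** Meant for the interior terms of the recurrence of [q]: their factorials are smaller than those
    of the two end terms by about the square of the index. *)
Lemma fact_mult_le_2 (a b : nat) :
  INR (fact (2 + a)) * INR (fact (2 + b)) <= 2 * INR (fact (2 + a + b)).
Proof.
replace 2 with (INR 2) by reflexivity.
rewrite <- 2!mult_INR; apply le_INR.
induction b as [|b IH].
- rewrite 2!Nat.add_0_r; change (fact 2) with 2%nat; lia.
- rewrite 2!Nat.add_succ_r, (fact_simpl (2 + b)), (fact_simpl (2 + a + b)); nia.
Qed.

(** [t] lists the coefficients of [tan], which satisfies [tan' = 1 + tan ^ 2]:
    [t k] is the coefficient of degree [2 * k + 1]. *)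
Definition tan_coefs (t : nat -> R) : Prop :=
  t 0%nat = 1 /\ forall k, INR (2 * k + 3) * t (S k)
    = sum_f_R0 (fun i => t i * t (k - i)%nat) k.

(** Compare the convolutions for two consecutive indices term by term: the longer one has an extra
    term [t (S k)], against an increase of 2 in the factor on the left. This is exactly enough for
    the ratio [1 / 2] and more than enough for [1 / 3]. *)
Lemma tan_coefs_bounds (t : nat -> R) : tan_coefs t ->
  forall k, 0 < t k /\ t k / 3 <= t (S k) <= t k / 2.
Proof.
intros [H0 Ht] k.
induction k as [[|k] IH] using (well_founded_induction lt_wf).
- generalize (Ht 0%nat); simpl; rewrite H0; lra.
- assert (0 < t (S k)) as Hp by (destruct (IH k) as [? [? ?]]; [lia|lra]).
  split; trivial.
  generalize (Ht (S k)); rewrite tech5, Nat.sub_diag, H0.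
  generalize (Ht k).
  replace (2 * S k + 3)%nat with (2 + (2 * k + 3))%nat by lia.
  rewrite (plus_INR 2); change (INR 2) with 2.
  assert (0 <= INR (2 * k + 3)) as HN by apply pos_INR.
  set (S1 := sum_f_R0 _ k); set (S2 := sum_f_R0 _ k); intros E1 E2.
  assert (S1 * / 3 <= S2 <= S1 * / 2) as [Hl Hu].
  { unfold S1, S2; rewrite 2!(Rmult_comm _ (/ _)), 2!scal_sum.
    split; apply sum_Rle; intros i Hi;
      replace (S k - i)%nat with (S (k - i)) by lia;
      destruct (IH i) as [Hi1 _]; try lia;
      destruct (IH (k - i)%nat) as [_ [Hi2 Hi3]]; try lia; nra. }
  split; apply (Rmult_le_reg_l (2 + INR (2 * k + 3))); lra.
Qed.

Lemma tan_coefs_shift (t : nat -> R) : tan_coefs t ->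
  forall i k, t k <= 3 ^ i * t (k + i)%nat.
Proof.
intros Ht i k; induction i as [|i IH].
- rewrite Nat.add_0_r; simpl; lra.
- rewrite Nat.add_succ_r.
  destruct (tan_coefs_bounds t Ht (k + i)) as [_ [H _]].
  assert (0 < 3 ^ i) by (apply pow_lt; lra).
  simpl; nra.
Qed.

Section ExpCoefsBounds.

Variables t p q : nat -> R.
Hypothesis Ht : tan_coefs t.
Hypothesis Hp0 : p 0%nat = 1.
Hypothesis Hp : forall k, INR (fact (2 * k + 3)) * p (S k)
  = INR (fact (2 * k + 3)) * t (S k)
    - sum_f_R0 (fun i => INR (fact (2 * i + 1)) * INR (fact (2 * (k - i)))
                         * t i * q (k - i)%nat) k.
Hypothesis Hq : forall k, INR (2 * k + 2) * INR (fact (2 * k)) * q k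
  = sum_f_R0 (fun i => INR (fact (2 * i + 1)) * INR (fact (2 * (k - i)))
                       * t i * p (k - i)%nat) k.

(** The subtracted sum is nonnegative. Its factorials multiply to at most [(2 k + 1)!], and the
    convolution that remains is that of [t (S k)]; dividing by [(2 k + 3)!] leaves the fraction
    [9 / 8 / (2 k + 2)] of [t (S k)]. *)
Lemma p_step (k : nat) :
  (forall j, (j <= k)%nat -> 0 <= q j <= 9 / 8 * t j) ->
  (1 - 9 / (16 * INR (S k))) * t (S k) <= p (S k) <= t (S k).
Proof.
intros H.
assert (forall j, 0 < t j) as Htp by (intros j; apply (tan_coefs_bounds t Ht)).
generalize (Hp k).
set (V := sum_f_R0 _ k); intros E.
assert (0 < INR (fact (2 * k + 1))) as Hf by apply INR_fact_lt_0.
assert (0 <= V) as HV0.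
{ apply cond_pos_sum; intros i.
  destruct (le_lt_dec i k) as [Hi|Hi].
  - generalize (H (k - i)%nat ltac:(lia)) (Htp i); intros [Hqi _] Hti.
    repeat apply Rmult_le_pos; trivial; try apply pos_INR; lra.
  - replace (k - i)%nat with 0%nat by lia.
    generalize (H 0%nat ltac:(lia)) (Htp i); intros [Hqi _] Hti.
    repeat apply Rmult_le_pos; trivial; try apply pos_INR; lra. }
assert (V <= 9 / 8 * INR (fact (2 * k + 1)) * (INR (2 * k + 3) * t (S k))) as HV.
{ rewrite (proj2 Ht), scal_sum; apply sum_Rle; intros i Hi.
  generalize (H (k - i)%nat ltac:(lia)) (Htp i); intros [Hq0 Hq1] Hti.
  generalize (fact_mult_le (2 * i + 1) (2 * (k - i))).
  replace (2 * i + 1 + 2 * (k - i))%nat with (2 * k + 1)%nat by lia.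
  generalize (INR_fact_lt_0 (2 * i + 1)) (INR_fact_lt_0 (2 * (k - i))).
  set (A := INR (fact (2 * i + 1))); set (B := INR (fact (2 * (k - i)))).
  set (C := INR (fact (2 * k + 1))) in *.
  intros HA HB HAB.
  apply Rle_trans with (C * (t i * q (k - i)%nat)).
  - rewrite Rmult_assoc; apply Rmult_le_compat_r; trivial.
    apply Rmult_le_pos; lra.
  - replace (t i * t (k - i)%nat * (9 / 8 * C)) with
      (C * (t i * (9 / 8 * t (k - i)%nat))) by ring.
    apply Rmult_le_compat_l; [lra|].
    apply Rmult_le_compat_l; lra. }
assert (INR (fact (2 * k + 3))
  = INR (2 * k + 3) * (2 * INR (S k)) * INR (fact (2 * k + 1))) as EF.
{ replace (2 * k + 3)%nat with (S (S (2 * k + 1))) by lia.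
  rewrite 2!fact_simpl, 2!mult_INR.
  replace (INR (S (2 * k + 1))) with (2 * INR (S k)); [ring|].
  change 2 with (INR 2) at 1; rewrite <- mult_INR; f_equal; lia. }
rewrite EF in E.
assert (0 < INR (2 * k + 3)) as HN by (apply lt_0_INR; lia).
assert (0 < INR (S k)) as HS by (apply lt_0_INR; lia).
set (Z := INR (2 * k + 3) * (2 * INR (S k)) * INR (fact (2 * k + 1))) in *.
assert (0 < Z) as HZ by (unfold Z; repeat apply Rmult_lt_0_compat; lra).
split; apply (Rmult_le_reg_l Z); trivial; rewrite E; [|lra].
replace (Z * ((1 - 9 / (16 * INR (S k))) * t (S k))) with
  (Z * t (S k) - 9 / 8 * INR (fact (2 * k + 1)) * (INR (2 * k + 3) * t (S k)));
  [lra|].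
unfold Z; field; lra.
Qed.

(** The two end terms give at most [t k], so [1 / 8] is the allowance for the interior terms, which
    exist only for [k >= 2]. *)
Lemma q_step (k : nat) :
  (forall j, (j <= k)%nat -> 0 <= p j <= t j) -> 0 <= q k <= 9 / 8 * t k.
Proof.
intros H.
assert (forall j, 0 < t j) as Htp by (intros j; apply (tan_coefs_bounds t Ht)).
assert (0 < INR (2 * k + 2)) as HN by (apply lt_0_INR; lia).
assert (0 < INR (fact (2 * k))) as Hf by apply INR_fact_lt_0.
assert (0 < INR (2 * k + 2) * INR (fact (2 * k))) as HZ
  by (apply Rmult_lt_0_compat; lra).
split; apply (Rmult_le_reg_l _ _ _ HZ); rewrite Hq.
- rewrite Rmult_0_r; apply cond_pos_sum; intros i.
  assert (0 <= p (k - i)%nat) by (apply H; lia).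
  generalize (Htp i); intros Hti.
  repeat apply Rmult_le_pos; trivial; try apply pos_INR; lra.
- destruct k as [|[|k]].
  + simpl; rewrite Hp0, (proj1 Ht); lra.
  + simpl.
    destruct (H 1%nat) as [_ H1]; [lia|].
    rewrite Hp0, (proj1 Ht).
    generalize (Htp 1%nat); lra.
  + rewrite decomp_sum by lia.
    simpl pred; rewrite tech5.
    rewrite Nat.sub_diag, Hp0, Nat.sub_0_r, (proj1 Ht).
    change (INR (fact (2 * 0))) with 1.
    change (INR (fact (2 * 0 + 1))) with 1.
    set (V := sum_f_R0 _ k).
    set (F := INR (fact (2 * k + 3))).
    assert (0 < F) as HF by apply INR_fact_lt_0.
    (* The interior terms are compared with the convolution of [t] without its two end terms, whence
       [- 2 * t (S (S k))]. *)
    assert (V <= 2 * F *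
      (INR (2 * S (S k) + 3) * t (S (S (S k))) - 2 * t (S (S k)))) as HV.
    { rewrite (proj2 Ht), decomp_sum by lia.
      simpl pred; rewrite tech5, Nat.sub_diag, Nat.sub_0_r, (proj1 Ht).
      replace (1 * t (S (S k)) + _ - _) with
        (sum_f_R0 (fun i => t (S i) * t (S (S k) - S i)%nat) k) by ring.
      rewrite scal_sum; apply sum_Rle; intros i Hi.
      generalize (fact_mult_le_2 (2 * i + 1) (2 * (k - i))).
      replace (2 * S i + 1)%nat with (2 + (2 * i + 1))%nat by lia.
      replace (2 * (S (S k) - S i))%nat with (2 + 2 * (k - i))%nat by lia.
      replace (2 + (2 * i + 1) + 2 * (k - i))%nat with (2 * k + 3)%nat by lia.
      fold F.
      generalize (INR_fact_lt_0 (2 + (2 * i + 1)))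
        (INR_fact_lt_0 (2 + 2 * (k - i))).
      set (A := INR (fact (2 + (2 * i + 1)))).
      set (B := INR (fact (2 + 2 * (k - i)))).
      intros HA HB HAB.
      destruct (H (S (S k) - S i)%nat) as [Hp1 Hp2]; [lia|].
      generalize (Htp (S i)); intros Hti.
      rewrite Rmult_assoc, (Rmult_comm _ (2 * F)).
      apply Rmult_le_compat; trivial.
      - apply Rmult_le_pos; lra.
      - apply Rmult_le_pos; lra.
      - apply Rmult_le_compat_l; lra. }
    destruct (H (S (S k))) as [_ H1]; [lia|].
    destruct (tan_coefs_bounds t Ht (S (S k))) as [Ht1 [_ Ht2]].
    set (T := t (S (S k))) in *.
    replace (S (S k) * 2)%nat with (2 * k + 4)%nat in * by lia.
    replace (2 * S (S k))%nat with (S (2 * k + 3)) in * by lia.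
    replace (S (2 * k + 3) + 1)%nat with (S (S (2 * k + 3))) by lia.
    rewrite (fact_simpl (S (2 * k + 3))), (fact_simpl (2 * k + 3)), !mult_INR.
    replace (INR (S (2 * k + 3) + 2)) with (2 * INR k + 6)
      by (rewrite plus_INR, S_INR, plus_INR, mult_INR; simpl; ring).
    replace (INR (S (2 * k + 3) + 3)) with (2 * INR k + 7) in HV
      by (rewrite plus_INR, S_INR, plus_INR, mult_INR; simpl; ring).
    replace (INR (S (S (2 * k + 3)))) with (2 * INR k + 5)
      by (rewrite !S_INR, plus_INR, mult_INR; simpl; ring).
    replace (INR (S (2 * k + 3))) with (2 * INR k + 4)
      by (rewrite !S_INR, plus_INR, mult_INR; simpl; ring).
    fold F.
    generalize (pos_INR k); set (x := INR k) in *; intros Hx.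
    apply Rle_trans with ((2 * x + 4) * F * T
      + (F * (2 * x + 3) * T + (2 * x + 5) * ((2 * x + 4) * F) * T)).
    * assert (V <= F * (2 * x + 3) * T).
      { eapply Rle_trans; [exact HV|].
        replace (F * (2 * x + 3) * T) with
          (2 * F * ((2 * x + 7) * (T / 2) - 2 * T)) by field.
        apply Rmult_le_compat_l; [lra|].
        apply Rplus_le_compat_r, Rmult_le_compat_l; lra. }
      assert ((2 * x + 4) * F * p (S (S k)) <= (2 * x + 4) * F * T)
        by (apply Rmult_le_compat_l; trivial; apply Rmult_le_pos; lra).
      lra.
    (* What remains is [2 x + 3 <= (2 x + 6) (2 x + 4) / 8], an equality at [x = 0]: this is the
       origin of [9 / 8]. *)
    * assert (0 < F * T) by (apply Rmult_lt_0_compat; trivial).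
      nra.
Qed.

(** The induction alternates: [p k] needs [q] strictly below [k], and [q k] needs [p] up to [k]. *)
Lemma pq_bounds (k : nat) : 0 <= p k <= t k /\ 0 <= q k <= 9 / 8 * t k.
Proof.
induction k as [k IH] using (well_founded_induction lt_wf).
assert (0 <= p k <= t k) as H.
{ destruct k as [|k].
  - rewrite Hp0, (proj1 Ht); lra.
  - destruct (p_step k) as [Hl Hu]; [intros j Hj; apply IH; lia|].
    split; trivial.
    eapply Rle_trans; [|exact Hl].
    destruct (tan_coefs_bounds t Ht (S k)) as [Hpos _].
    apply Rmult_le_pos; [|lra].
    assert (1 <= INR (S k)) as HS by (rewrite S_INR; generalize (pos_INR k); lra).
    assert (9 / (16 * INR (S k)) <= 1); [|lra].
    apply (Rmult_le_reg_r (16 * INR (S k))); [lra|].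
    unfold Rdiv; rewrite Rmult_assoc, Rinv_l by lra; lra. }
split; trivial.
apply q_step; intros j Hj.
destruct (Nat.eq_dec j k) as [->|Hne]; trivial.
apply IH; lia.
Qed.

Lemma p_lower (k : nat) : (1 - 9 / (16 * INR (S k))) * t (S k) <= p (S k).
Proof. apply p_step; intros; apply pq_bounds. Qed.

End ExpCoefsBounds.

(** Here [3 / 4 = 3 (1 / 2) ^ 2] combines the growth of [t] with the bound on [g]. Each step divides
    by at least 12, and by at least 20 in the odd case, giving the ratios [1 / 16] and [3 / 80]. *)
Lemma pow_div_fact_even (i : nat) :
  (3 / 4) ^ S i / INR (fact (2 * S i)) <= 3 / 8 * (1 / 16) ^ i.
Proof.
induction i as [|i IH]; [simpl; lra|].
replace (2 * S (S i))%nat with (S (S (2 * S i))) by lia.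
rewrite 2!fact_simpl, 2!mult_INR.
assert (4 <= INR (S (S (2 * S i)))) as H4
  by (replace 4 with (INR 4) by (simpl; ring); apply le_INR; lia).
assert (3 <= INR (S (2 * S i))) as H3
  by (replace 3 with (INR 3) by (simpl; ring); apply le_INR; lia).
assert (0 < INR (fact (2 * S i))) as Hf by apply INR_fact_lt_0.
set (x := INR (S (S (2 * S i)))) in *; set (y := INR (S (2 * S i))) in *.
set (f := INR (fact (2 * S i))) in *.
replace ((3 / 4) ^ S (S i) / (x * (y * f))) with
  ((3 / 4) ^ S i / f * (3 / 4 * / (x * y))) by (simpl pow; field; lra).
replace (3 / 8 * (1 / 16) ^ S i) with (3 / 8 * (1 / 16) ^ i * (1 / 16))
  by (simpl; ring).
assert (/ (x * y) <= / 12) by (apply Rinv_le_contravar; nra).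
assert (0 < / (x * y)) by (apply Rinv_0_lt_compat; nra).
apply Rmult_le_compat; trivial; try lra.
apply Rdiv_le_0_compat; trivial; apply pow_le; lra.
Qed.

Lemma pow_div_fact_odd (i : nat) :
  (3 / 4) ^ S i / INR (fact (2 * S i + 1)) <= 1 / 8 * (3 / 80) ^ i.
Proof.
induction i as [|i IH]; [simpl; lra|].
replace (2 * S (S i) + 1)%nat with (S (S (2 * S i + 1))) by lia.
rewrite 2!fact_simpl, 2!mult_INR.
assert (5 <= INR (S (S (2 * S i + 1)))) as H4
  by (replace 5 with (INR 5) by (simpl; ring); apply le_INR; lia).
assert (4 <= INR (S (2 * S i + 1))) as H3
  by (replace 4 with (INR 4) by (simpl; ring); apply le_INR; lia).
assert (0 < INR (fact (2 * S i + 1))) as Hf by apply INR_fact_lt_0.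
set (x := INR (S (S (2 * S i + 1)))) in *; set (y := INR (S (2 * S i + 1))) in *.
set (f := INR (fact (2 * S i + 1))) in *.
replace ((3 / 4) ^ S (S i) / (x * (y * f))) with
  ((3 / 4) ^ S i / f * (3 / 4 * / (x * y))) by (simpl pow; field; lra).
replace (1 / 8 * (3 / 80) ^ S i) with (1 / 8 * (3 / 80) ^ i * (3 / 80))
  by (simpl; ring).
assert (/ (x * y) <= / 20) by (apply Rinv_le_contravar; nra).
assert (0 < / (x * y)) by (apply Rinv_0_lt_compat; nra).
apply Rmult_le_compat; trivial; try lra.
apply Rdiv_le_0_compat; trivial; apply pow_le; lra.
Qed.

Lemma Rabs_sum_le_geometric (a : nat -> R) (c x : R) (n : nat) :
  0 <= c -> 0 <= x < 1 -> (forall i, (i <= n)%nat -> Rabs (a i) <= c * x ^ i) ->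
  Rabs (sum_f_R0 a n) <= c / (1 - x).
Proof.
intros Hc Hx H.
eapply Rle_trans; [apply Rsum_abs|].
apply Rle_trans with (c * sum_f_R0 (fun i => x ^ i) n).
- rewrite scal_sum; apply sum_Rle; intros i Hi.
  rewrite Rmult_comm; apply H, Hi.
- apply Rmult_le_compat_l; trivial.
  apply sum_geometric_le, Hx.
Qed.

(** * Propagation of the bounds on [A] and [g] *)

Section Recurrence.

Variables t A g : nat -> R.
Hypothesis Ht : tan_coefs t.

Definition bounded_upto (k : nat) : Prop :=
  forall m, (m <= k)%nat -> 0 < A m <= 5 / 3 * t m /\ Rabs (g m) <= 1 / 2.

Lemma even_term_bound (k i : nat) : bounded_upto k -> (i <= k)%nat ->
  Rabs ((-1) ^ S i * A (S k - S i)%nat * g (S k - S i)%nat ^ (2 * S i)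
        / INR (fact (2 * S i)))
  <= 5 / 3 * t (S k) * (3 / 8) * (1 / 16) ^ i.
Proof.
intros Hinv Hi.
destruct (Hinv (S k - S i)%nat) as [[HA0 HA] Hg]; [lia|].
generalize (tan_coefs_shift t Ht (S i) (S k - S i)).
replace (S k - S i + S i)%nat with (S k) by lia.
set (m := (S k - S i)%nat) in *; intros Hs.
generalize (INR_fact_lt_0 (2 * S i)) (pow_div_fact_even i).
set (f := INR (fact (2 * S i))); intros Hf He.
unfold Rdiv at 1; rewrite 3!Rabs_mult, pow_1_abs, Rmult_1_l.
rewrite (Rabs_pos_eq (A m)), (Rabs_pos_eq (/ f)), <- RPow_abs
  by (try (left; apply Rinv_0_lt_compat); lra).
apply Rle_trans with (5 / 3 * (3 ^ S i * t (S k)) * (1 / 2) ^ (2 * S i) * / f).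
- apply Rmult_le_compat_r; [left; apply Rinv_0_lt_compat; lra|].
  apply Rmult_le_compat; try lra.
  + apply pow_le, Rabs_pos.
  + apply pow_incr; split; [apply Rabs_pos|exact Hg].
- replace (5 / 3 * (3 ^ S i * t (S k)) * (1 / 2) ^ (2 * S i) * / f) with
    (5 / 3 * t (S k) * ((3 / 4) ^ S i / f)).
  2:{ rewrite pow_mult.
      replace (3 / 4) with (3 * (1 / 2) ^ 2) by (simpl; field).
      rewrite Rpow_mult_distr; unfold Rdiv; ring. }
  rewrite (Rmult_assoc (5 / 3 * t (S k))).
  apply Rmult_le_compat_l; trivial.
  destruct (tan_coefs_bounds t Ht (S k)); lra.
Qed.

Lemma odd_term_bound (k i : nat) : bounded_upto k -> (i <= k)%nat ->
  Rabs ((-1) ^ S i * A (S k - S i)%nat * g (S k - S i)%nat ^ (2 * S i + 1)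
        / INR (fact (2 * S i + 1)))
  <= 5 / 3 * t (S k) * (1 / 16) * (3 / 80) ^ i.
Proof.
intros Hinv Hi.
destruct (Hinv (S k - S i)%nat) as [[HA0 HA] Hg]; [lia|].
generalize (tan_coefs_shift t Ht (S i) (S k - S i)).
replace (S k - S i + S i)%nat with (S k) by lia.
set (m := (S k - S i)%nat) in *; intros Hs.
generalize (INR_fact_lt_0 (2 * S i + 1)) (pow_div_fact_odd i).
set (f := INR (fact (2 * S i + 1))); intros Hf He.
unfold Rdiv at 1; rewrite 3!Rabs_mult, pow_1_abs, Rmult_1_l.
rewrite (Rabs_pos_eq (A m)), (Rabs_pos_eq (/ f)), <- RPow_abs
  by (try (left; apply Rinv_0_lt_compat); lra).
apply Rle_trans with
  (5 / 3 * (3 ^ S i * t (S k)) * (1 / 2) ^ (2 * S i + 1) * / f).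
- apply Rmult_le_compat_r; [left; apply Rinv_0_lt_compat; lra|].
  apply Rmult_le_compat; try lra.
  + apply pow_le, Rabs_pos.
  + apply pow_incr; split; [apply Rabs_pos|exact Hg].
- replace (5 / 3 * (3 ^ S i * t (S k)) * (1 / 2) ^ (2 * S i + 1) * / f) with
    (5 / 3 * t (S k) * (1 / 2 * ((3 / 4) ^ S i / f))).
  2:{ rewrite pow_add, pow_mult.
      replace (3 / 4) with (3 * (1 / 2) ^ 2) by (simpl; field).
      rewrite Rpow_mult_distr; unfold Rdiv; ring. }
  rewrite (Rmult_assoc (5 / 3 * t (S k))).
  apply Rmult_le_compat_l; [|lra].
  destruct (tan_coefs_bounds t Ht (S k)); lra.
Qed.

(** All corrections together are at most [2 / 3 t], so [p <= t] reproduces the constant [5 / 3].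
    Those from the second on amount to at most [1 / 24 t]. *)
Lemma A_bounds (k : nat) (p : R) : bounded_upto k ->
  (1 - 9 / (16 * INR (S k))) * t (S k) <= p <= t (S k) ->
  p = sum_f_R0 (fun i => (-1) ^ i * A (S k - i)%nat * g (S k - i)%nat ^ (2 * i)
                         / INR (fact (2 * i))) (S k) ->
  (1 - 9 / (16 * INR (S k)) - 1 / 24) * t (S k) <= A (S k) <= 5 / 3 * t (S k).
Proof.
intros Hinv [Hp0 Hp1] E.
assert (0 < t (S k)) as Htp by apply (tan_coefs_bounds t Ht).
rewrite decomp_sum in E by lia.
simpl pred in E.
replace ((-1) ^ 0 * A (S k - 0)%nat * g (S k - 0)%nat ^ (2 * 0)
         / INR (fact (2 * 0))) with (A (S k)) in E by (simpl; field).
split.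
- (* The first correction is favourable, so only the next ones are estimated. *)
  assert ((-1) ^ 1 * A (S k - 1)%nat * g (S k - 1)%nat ^ (2 * 1)
     / INR (fact (2 * 1)) <= 0) as H1.
  { destruct (Hinv (S k - 1)%nat) as [[HA _] _]; [lia|].
    simpl fact; simpl INR; simpl pow.
    set (a := A _) in *; set (b := g _); nra. }
  assert (forall n, (n < k)%nat -> Rabs (sum_f_R0 (fun i => (-1) ^ S (S i)
      * A (S k - S (S i))%nat * g (S k - S (S i))%nat ^ (2 * S (S i))
      / INR (fact (2 * S (S i)))) n) <= 1 / 24 * t (S k)) as H2.
  { intros n Hn.
    replace (1 / 24 * t (S k)) with
      (5 / 3 * t (S k) * (3 / 8) * (1 / 16) / (1 - 1 / 16)) by field.
    apply Rabs_sum_le_geometric; try lra.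
    intros i Hi.
    eapply Rle_trans; [apply (even_term_bound k (S i)); trivial; lia|].
    simpl pow; lra. }
  clear Hinv; destruct k as [|k'].
  + cbn [sum_f_R0] in E; lra.
  + rewrite decomp_sum in E by lia.
    simpl pred in E.
    specialize (H2 k' ltac:(lia)).
    apply Rabs_le_between in H2; lra.
- assert (Rabs (sum_f_R0 (fun i => (-1) ^ S i * A (S k - S i)%nat
      * g (S k - S i)%nat ^ (2 * S i) / INR (fact (2 * S i))) k)
    <= 2 / 3 * t (S k)) as H2.
  { replace (2 / 3 * t (S k)) with
      (5 / 3 * t (S k) * (3 / 8) / (1 - 1 / 16)) by field.
    apply Rabs_sum_le_geometric; try lra.
    intros i; apply even_term_bound, Hinv. }
  apply Rabs_le_between in H2; lra.
Qed.

(** From index 2 on, [9 / 40 + 25 / 231 <= 1 / 2 * (65 / 96)], with little to spare. At index 1 the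
    lower bound on [A] is too weak, hence the hypothesis [1 <= k]. *)
Lemma g_bound (k : nat) (q : R) : (1 <= k)%nat -> bounded_upto k ->
  0 <= q <= 9 / 8 * t (S k) ->
  (1 - 9 / (16 * INR (S k)) - 1 / 24) * t (S k) <= A (S k) ->
  q / INR (2 * S k + 1)
  = sum_f_R0 (fun i => (-1) ^ i * A (S k - i)%nat
      * g (S k - i)%nat ^ (2 * i + 1) / INR (fact (2 * i + 1))) (S k) ->
  Rabs (g (S k)) <= 1 / 2.
Proof.
intros Hk Hinv [Hq0 Hq1] HA E.
assert (0 < t (S k)) as Htp by apply (tan_coefs_bounds t Ht).
rewrite decomp_sum in E by lia.
simpl pred in E.
replace ((-1) ^ 0 * A (S k - 0)%nat * g (S k - 0)%nat ^ (2 * 0 + 1)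
         / INR (fact (2 * 0 + 1))) with (A (S k) * g (S k)) in E
  by (simpl; field).
assert (Rabs (sum_f_R0 (fun i => (-1) ^ S i * A (S k - S i)%nat
    * g (S k - S i)%nat ^ (2 * S i + 1) / INR (fact (2 * S i + 1))) k)
  <= 25 / 231 * t (S k)) as H2.
{ replace (25 / 231 * t (S k)) with
    (5 / 3 * t (S k) * (1 / 16) / (1 - 3 / 80)) by field.
  apply Rabs_sum_le_geometric; try lra.
  intros i; apply odd_term_bound, Hinv. }
set (V := sum_f_R0 _ k) in *.
assert (0 <= q / INR (2 * S k + 1) <= 9 / 40 * t (S k)) as Hq.
{ assert (5 <= INR (2 * S k + 1)) as H5
    by (replace 5 with (INR 5) by (simpl; ring); apply le_INR; lia).
  assert (0 < / INR (2 * S k + 1) <= / 5).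
  { split; [apply Rinv_0_lt_compat; lra|apply Rinv_le_contravar; lra]. }
  unfold Rdiv; split; nra. }
assert (65 / 96 * t (S k) <= A (S k)) as HA'.
{ eapply Rle_trans; [|exact HA].
  apply Rmult_le_compat_r; [lra|].
  assert (2 <= INR (S k)) as H5
    by (replace 2 with (INR 2) by (simpl; ring); apply le_INR; lia).
  assert (9 / (16 * INR (S k)) <= 9 / 32); [|lra].
  apply Rmult_le_compat_l; [lra|apply Rinv_le_contravar; lra]. }
assert (Rabs (A (S k) * g (S k)) <= 1 / 2 * A (S k)) as H.
{ apply Rabs_le_between in H2; apply Rabs_le; lra. }
rewrite Rabs_mult, (Rabs_pos_eq (A (S k))) in H by lra.
apply (Rmult_le_reg_l (A (S k))); lra.
Qed.

End Recurrence.

(** * Normalized coefficients *)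

(** Oddness is read off the Riccati equation: in an odd-degree convolution every product has a
    factor of even index. *)
Lemma tauc_even (B : nat -> R) (k : nat) : is_bernoulli B -> tauc B (2 * k) = 0.
Proof.
intros HB; induction k as [[|k] IH] using (well_founded_induction lt_wf).
- apply tauc_0, HB.
- replace (2 * S k)%nat with (S (2 * k + 1)) by lia.
  apply (Rmult_eq_reg_l (INR (S (2 * k + 1)))); [|apply not_0_INR; lia].
  rewrite tauc_riccati by trivial.
  replace (monomial 0 (2 * k + 1)) with 0
    by (unfold monomial; rewrite (proj2 (Nat.eqb_neq _ _)) by lia; reflexivity).
  unfold PS_mult; rewrite sum_even_odd, sum_f_R0_0; [ring|].
  intros i Hi; rewrite (IH i) by lia.
  replace (2 * k + 1 - (2 * i + 1))%nat with (2 * (k - i))%nat by lia.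
  rewrite (IH (k - i)%nat) by lia; ring.
Qed.

(** The odd coefficients of [tau] with the factors [4 ^ (2 * k + 1)] and
    [(-1) ^ (k + 1)] of [- tanh (x / 4)] removed. *)
Definition tanc (B : nat -> R) (k : nat) : R :=
  -4 * (-16) ^ k * tauc B (2 * k + 1).

(** Removing the powers of 4 and the alternating signs turns [tanh' = 1 - tanh ^ 2] into
    [tan' = 1 + tan ^ 2]. *)
Lemma tan_coefs_tanc (B : nat -> R) : is_bernoulli B -> tan_coefs (tanc B).
Proof.
intros HB; split.
- generalize (tauc_riccati B 0 HB).
  unfold tanc, PS_mult, monomial; simpl.
  rewrite tauc_0 by trivial; lra.
- intros k.
  generalize (tauc_riccati B (2 * k + 2) HB).
  replace (monomial 0 (2 * k + 2)) with 0
    by (unfold monomial; rewrite (proj2 (Nat.eqb_neq _ _)) by lia; reflexivity).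
  replace (2 * k + 2)%nat with (S (2 * k + 1)) by lia.
  unfold PS_mult; rewrite tech5, Nat.sub_diag, tauc_0, sum_even_odd by trivial.
  intros E.
  unfold tanc; replace (2 * S k + 1)%nat with (S (S (2 * k + 1))) by lia.
  replace (2 * k + 3)%nat with (S (S (2 * k + 1))) by lia.
  rewrite <- Rmult_assoc, (Rmult_comm (INR _)), Rmult_assoc, E.
  replace (sum_f_R0 _ k) with (sum_f_R0 (fun i =>
    tauc B (2 * i + 1) * tauc B (2 * (k - i) + 1)) k).
  2:{ apply sum_eq; intros i Hi; rewrite tauc_even by trivial.
      replace (S (2 * k + 1) - (2 * i + 1))%nat with (2 * (k - i) + 1)%nat by lia.
      ring. }
  rewrite Rmult_0_r, Rplus_0_r, Rminus_0_l.
  replace (-4 * (-16) ^ S k * _) with (16 * (-16) ^ k * sum_f_R0 (fun i =>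
    tauc B (2 * i + 1) * tauc B (2 * (k - i) + 1)) k) by (simpl pow; field).
  rewrite scal_sum; apply sum_eq; intros i Hi.
  replace ((-16) ^ k) with ((-16) ^ i * (-16) ^ (k - i))
    by (rewrite <- pow_add; f_equal; lia).
  ring.
Qed.

Section NormalizedCoefs.

Variables B c : nat -> R.
Hypothesis HB : is_bernoulli B.
Hypothesis Hc : exp_coefs (logc B) c.

(** The factor is chosen so that [logc B] in place of [c] would give [tanc B]. That of [evenc] is
    the product of two such odd factors, so that the convolutions lose all their signs. *)
Definition oddc (k : nat) : R :=
  -4 * (-16) ^ k * c (2 * k + 1)%nat / INR (fact (2 * k)).

Definition evenc (k : nat) : R :=
  16 * (-16) ^ k * c (2 * k + 2)%nat / INR (fact (2 * k)).

Lemma logc_deriv (i : nat) :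
  INR (S i) * logc B (S i) = INR (fact (S i)) * tauc B (S i).
Proof. unfold logc; rewrite fact_simpl, mult_INR; ring. Qed.

Lemma oddc_0 : oddc 0 = 1.
Proof.
destruct Hc as [H0 H].
generalize (H 0%nat) (proj1 (tan_coefs_tanc B HB)).
unfold oddc, tanc, logc; simpl; rewrite H0; lra.
Qed.

Lemma oddc_rec (k : nat) : INR (fact (2 * k + 3)) * oddc (S k)
  = INR (fact (2 * k + 3)) * tanc B (S k)
    - sum_f_R0 (fun i => INR (fact (2 * i + 1)) * INR (fact (2 * (k - i)))
                         * tanc B i * evenc (k - i)) k.
Proof.
destruct Hc as [H0 H].
generalize (H (S (2 * k + 1))).
rewrite (sum_eq _ (fun i => INR (fact (S i)) * tauc B (S i) * c (S (2 * k + 1) - i)%nat))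
  by (intros i _; rewrite logc_deriv; reflexivity).
rewrite tech5, Nat.sub_diag, H0, sum_even_odd.
replace (S (S (2 * k + 1))) with (2 * k + 3)%nat by lia.
replace (sum_f_R0 _ k) with (sum_f_R0 (fun i =>
  INR (fact (2 * i + 1)) * tauc B (2 * i + 1) * c (2 * (k - i) + 2)%nat) k).
2:{ apply sum_eq; intros i Hi.
    replace (S (2 * i + 1)) with (2 * S i)%nat by lia.
    rewrite (tauc_even B (S i)) by trivial.
    replace (S (2 * k + 1) - 2 * i)%nat with (2 * (k - i) + 2)%nat by lia.
    replace (S (2 * i)) with (2 * i + 1)%nat by lia; ring. }
intros E.
unfold oddc at 1, tanc at 1.
replace (2 * S k + 1)%nat with (2 * k + 3)%nat by lia.
replace (INR (fact (2 * k + 3)) *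
  (-4 * (-16) ^ S k * c (2 * k + 3)%nat / INR (fact (2 * S k)))) with
  (-4 * (-16) ^ S k * (INR (2 * k + 3) * c (2 * k + 3)%nat)).
2:{ replace (2 * k + 3)%nat with (S (2 * S k)) by lia.
    rewrite fact_simpl, mult_INR; field; apply INR_fact_neq_0. }
rewrite E, Rmult_plus_distr_l, scal_sum.
rewrite Rplus_comm; unfold Rminus; f_equal; [ring|].
rewrite <- (Rmult_1_l (sum_f_R0 (fun i => _ * evenc _) k)), Ropp_mult_distr_l, scal_sum.
apply sum_eq; intros i Hi.
unfold tanc, evenc.
replace ((-16) ^ S k) with (-16 * ((-16) ^ i * (-16) ^ (k - i)))
  by (rewrite <- pow_add; simpl; do 2 f_equal; lia).
field; apply INR_fact_neq_0.
Qed.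

Lemma evenc_rec (k : nat) : INR (2 * k + 2) * INR (fact (2 * k)) * evenc k
  = sum_f_R0 (fun i => INR (fact (2 * i + 1)) * INR (fact (2 * (k - i)))
                       * tanc B i * oddc (k - i)) k.
Proof.
destruct Hc as [H0 H].
generalize (H (2 * k + 1)%nat).
rewrite (sum_eq _ (fun i => INR (fact (S i)) * tauc B (S i) * c (2 * k + 1 - i)%nat))
  by (intros i _; rewrite logc_deriv; reflexivity).
rewrite sum_even_odd.
replace (S (2 * k + 1)) with (2 * k + 2)%nat by lia.
replace (sum_f_R0 _ k) with (sum_f_R0 (fun i =>
  INR (fact (2 * i + 1)) * tauc B (2 * i + 1) * c (2 * (k - i) + 1)%nat) k).
2:{ apply sum_eq; intros i Hi.
    replace (S (2 * i + 1)) with (2 * S i)%nat by lia.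
    rewrite (tauc_even B (S i)) by trivial.
    replace (2 * k + 1 - 2 * i)%nat with (2 * (k - i) + 1)%nat by lia.
    replace (S (2 * i)) with (2 * i + 1)%nat by lia; ring. }
intros E.
replace (INR (2 * k + 2) * INR (fact (2 * k)) * evenc k) with
  (16 * (-16) ^ k * (INR (2 * k + 2) * c (2 * k + 2)%nat))
  by (unfold evenc; field; apply INR_fact_neq_0).
rewrite E, scal_sum; apply sum_eq; intros i Hi.
unfold tanc, oddc.
replace ((-16) ^ k) with ((-16) ^ i * (-16) ^ (k - i))
  by (rewrite <- pow_add; f_equal; lia).
field; apply INR_fact_neq_0.
Qed.

Lemma oddc_evenc_bounds (k : nat) :
  0 <= oddc k <= tanc B k /\ 0 <= evenc k <= 9 / 8 * tanc B k.
Proof.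
apply pq_bounds; [apply tan_coefs_tanc, HB|exact oddc_0|exact oddc_rec|exact evenc_rec].
Qed.

Lemma oddc_lower (k : nat) :
  (1 - 9 / (16 * INR (S k))) * tanc B (S k) <= oddc (S k).
Proof.
apply (p_lower (tanc B) oddc evenc);
  [apply tan_coefs_tanc, HB|exact oddc_0|exact oddc_rec|exact evenc_rec].
Qed.

End NormalizedCoefs.

Lemma pw_odd_odd (b : R) (i N : nat) : (i <= N)%nat ->
  pw b (2 * i + 1) (2 * N + 1)
  = b ^ (2 * (N - i)) * Binomial.C (2 * N) (2 * (N - i)).
Proof.
intros Hi.
replace (2 * i + 1)%nat with (S (2 * i)) by lia.
replace (2 * N + 1)%nat with (S (2 * i) + 2 * (N - i))%nat by lia.
rewrite pw_closed; unfold Binomial.C.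
replace (2 * i + 2 * (N - i))%nat with (2 * N)%nat by lia.
replace (2 * N - 2 * (N - i))%nat with (2 * i)%nat by lia.
rewrite 2!pow_mult; replace ((- b) ^ 2) with (b ^ 2) by ring.
field; split; apply INR_fact_neq_0.
Qed.

(** The odd number of factors [- b] yields the sign that makes the sum in the recurrence of [beta]
    added rather than subtracted. *)
Lemma pw_odd_even (b : R) (i N : nat) : (i <= N)%nat ->
  pw b (2 * i + 1) (2 * N + 2)
  = - (b ^ (2 * (N - i) + 1) * Binomial.C (2 * N + 1) (2 * (N - i) + 1)).
Proof.
intros Hi.
replace (2 * i + 1)%nat with (S (2 * i)) by lia.
replace (2 * N + 2)%nat with (S (2 * i) + (2 * (N - i) + 1))%nat by lia.
rewrite pw_closed; unfold Binomial.C.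
replace (2 * i + (2 * (N - i) + 1))%nat with (2 * N + 1)%nat by lia.
replace (2 * N + 1 - (2 * (N - i) + 1))%nat with (2 * i)%nat by lia.
rewrite 2!pow_add, 2!pow_mult; replace ((- b) ^ 2) with (b ^ 2) by ring.
field; split; apply INR_fact_neq_0.
Qed.

Lemma inv_INR_lim : is_lim_seq (fun n => / INR n) 0.
Proof.
apply (is_lim_seq_inv INR p_infty); [apply is_lim_seq_INR|discriminate].
Qed.

Lemma inv_INR_neq_0 : eventually (fun n => / INR n <> 0).
Proof.
exists 1%nat; intros n Hn; apply Rinv_neq_0_compat, not_0_INR; lia.
Qed.

Lemma half_step_inv_INR :
  eventually (fun n => half_step n = / INR n / (1 + 1 / 2 * / INR n)).
Proof.
exists 1%nat; intros n Hn; unfold half_step.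
assert (0 < INR n) by (apply lt_0_INR; lia).
field; repeat split; lra.
Qed.

Lemma expands_inv_pow (b : R) (k : nat) :
  expands (fun n => / INR n) (pw b k) (fun n => (/ (INR n + b)) ^ k).
Proof.
generalize (expands_pw _ b k inv_INR_lim).
apply expands_ext; trivial.
generalize (eventually_half_le _ b inv_INR_lim); intros [N HN].
exists (S N); intros n Hn; f_equal.
assert (0 < INR n) as Hn0 by (apply lt_0_INR; lia).
generalize (HN n ltac:(lia)); intros H.
assert (0 < INR n + b).
{ replace (INR n + b) with (INR n * (1 + b * / INR n)) by (field; lra).
  apply Rmult_lt_0_compat; lra. }
field; lra.
Qed.

Lemma expands_inv_pow_half (b : R) (k : nat) :
  expands half_step (pw (b - 1 / 2) k) (fun n => (/ (INR n + b)) ^ k).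
Proof.
generalize (expands_pw _ (b - 1 / 2) k half_step_lim).
apply expands_ext; trivial.
generalize (eventually_half_le _ (b - 1 / 2) half_step_lim); intros [N HN].
exists N; intros n Hn; f_equal.
generalize (HN n Hn); unfold half_step; intros H.
assert (0 <= INR n) as Hn0 by apply pos_INR.
assert (0 < INR n + b).
{ replace (INR n + b) with
    ((INR n + 1 / 2) * (1 + (b - 1 / 2) * / (INR n + 1 / 2))) by (field; lra).
  apply Rmult_lt_0_compat; lra. }
field; lra.
Qed.

(** By uniqueness, expanding one function in both variables suffices. This serves for [mu] against
    [c] and also for composing two shifts in [pw]. *)
Lemma expands_change_step (a a' F : nat -> R) :
  expands (fun n => / INR n) a F -> expands half_step a' F ->
  forall j, a j = sum_f_R0 (fun k => a' k * pw (1 / 2) k j) j.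
Proof.
intros H H'.
apply (expands_unique (fun n => / INR n) _ _ F inv_INR_lim inv_INR_neq_0 H).
apply (expands_reexpand _ half_step); trivial;
  [exact inv_INR_lim|exact half_step_inv_INR].
Qed.

Lemma triangular_vanish (r r' : nat -> R) (s : R) (m : nat) :
  (forall j, r j = sum_f_R0 (fun k => r' k * pw s k j) j) ->
  (forall j, (j <= m)%nat -> r j = 0) -> forall j, (j <= m)%nat -> r' j = 0.
Proof.
intros Hr H0 j; induction j as [j IH] using (well_founded_induction lt_wf).
intros Hj; generalize (Hr j); rewrite H0 by exact Hj.
destruct j as [|j]; [simpl; lra|].
rewrite tech5, pw_diag, sum_f_R0_0; [lra|].
intros i Hi; rewrite IH by lia; ring.
Qed.

(** * Translation between the two variables *)

Lemma powerRZ_2_opp (n : nat) : powerRZ 2 (- Z.of_nat n) = (1 / 2) ^ n.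
Proof.
rewrite powerRZ_neg', <- pow_powerRZ, <- pow_inv; f_equal; field.
Qed.

(** The sign [(-1) ^ (j + 1)] in [nu] encodes the oddness of [tau], which matches it with the minus
    sign in [tauc_half]. *)
Lemma nu_logc (B nu : nat -> R) (j : nat) : is_bernoulli B ->
  (forall j : nat, (1 <= j)%nat ->
     nu j = (-1) ^ (j + 1)
            * ((4 - powerRZ 2 (1 - Z.of_nat j)) * B (j + 1)%nat
               - INR (j + 1) * powerRZ 2 (- Z.of_nat j))
            / (INR j * INR (j + 1))) ->
  nu (S j) = sum_f_R0 (fun k => logc B k * pw (1 / 2) k (S j)) (S j).
Proof.
intros HB H.
assert ((-1) ^ S j * tauc B (S j) = - tauc B (S j)) as Hpar.
{ destruct (Nat.Even_or_Odd (S j)) as [[i Hi]|[i Hi]]; rewrite Hi.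
  - rewrite tauc_even by trivial; ring.
  - rewrite pow_add, pow_mult; replace ((-1) ^ 2) with 1 by ring.
    rewrite pow1; ring. }
rewrite logc_pw, tauc_half by trivial.
rewrite <- Hpar, H by lia.
replace (1 - Z.of_nat (S j))%Z with (- Z.of_nat j)%Z by lia.
rewrite 2!powerRZ_2_opp, Nat.add_1_r.
unfold tauc, expc.
replace (- (1 / 2)) with (-1 * (1 / 2)) by field.
rewrite Rpow_mult_distr.
change (monomial 0 (S j)) with 0.
rewrite (fact_simpl (S j)), (fact_simpl j), 2!mult_INR.
assert (INR (fact j) <> 0) by apply INR_fact_neq_0.
assert (INR (S j) <> 0) by (apply not_0_INR; lia).
assert (INR (S (S j)) <> 0) by (apply not_0_INR; lia).
set (x := INR (S j)) in *; set (y := INR (S (S j))) in *.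
simpl pow; field; repeat split; trivial.
Qed.

Lemma exp_coefs_mu (B nu mu : nat -> R) : is_bernoulli B ->
  (forall j : nat, (1 <= j)%nat ->
     nu j = (-1) ^ (j + 1)
            * ((4 - powerRZ 2 (1 - Z.of_nat j)) * B (j + 1)%nat
               - INR (j + 1) * powerRZ 2 (- Z.of_nat j))
            / (INR j * INR (j + 1))) ->
  mu 0%nat = 1 ->
  (forall j : nat, (1 <= j)%nat ->
     mu j = 1 / INR j * sum_n_m (fun k => INR k * nu k * mu (j - k)%nat) 1 j) ->
  exp_coefs (fun j => sum_f_R0 (fun k => logc B k * pw (1 / 2) k j) j) mu.
Proof.
intros HB Hnu H0 H; split; trivial.
intros j; rewrite H, sum_n_m_from_1 by lia.
unfold Rdiv; rewrite Rmult_1_l, <- Rmult_assoc, Rinv_r, Rmult_1_l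
  by (apply not_0_INR; lia).
apply sum_eq; intros k Hk.
rewrite (nu_logc B nu) by trivial; reflexivity.
Qed.

Lemma expands_exp_log_wallis (e a m : nat -> R) :
  is_lim_seq e 0 -> a 0%nat = 0 -> exp_coefs a m ->
  expands e a (fun n => ln (wallis n / (PI / 2))) ->
  expands e m (fun n => wallis n / (PI / 2)).
Proof.
intros He Ha Hm H.
generalize (expands_exp e a m _ He Ha Hm H).
apply expands_ext; trivial.
exists 0%nat; intros n _; apply exp_ln.
apply Rdiv_lt_0_compat; [apply wallis_pos|generalize PI_RGT_0; lra].
Qed.

Section Translation.

Variables a b c : nat -> R.

(** The normalization of [oddc]; the factor 4 in [normal_shift] absorbs the remaining powers of 16,
    and the binomials become inverse factorials. *)
Definition normal_coef (l : nat) : R := -4 * (-16) ^ l * a l / INR (fact (2 * l)).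

Definition normal_shift (l : nat) : R := 4 * (b l - 1 / 2).

Lemma normal_odd (N : nat) :
  c (2 * N + 1)%nat
  = sum_f_R0 (fun l => a l * pw (b l - 1 / 2) (2 * l + 1) (2 * N + 1)) N ->
  oddc c N = sum_f_R0 (fun i => (-1) ^ i * normal_coef (N - i)
    * normal_shift (N - i) ^ (2 * i) / INR (fact (2 * i))) N.
Proof.
intros E; unfold oddc; rewrite E, sum_f_R0_rev.
unfold Rdiv at 1; rewrite Rmult_assoc, (Rmult_comm (sum_f_R0 _ _)), <- Rmult_assoc.
rewrite scal_sum; apply sum_eq; intros i Hi.
rewrite pw_odd_odd by lia.
unfold Binomial.C, normal_coef, normal_shift.
replace (N - (N - i))%nat with i by lia.
replace (2 * N - 2 * i)%nat with (2 * (N - i))%nat by lia.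
replace ((-16) ^ N) with ((-16) ^ (N - i) * ((-1) ^ i * 16 ^ i)).
2:{ rewrite <- Rpow_mult_distr; replace (-1 * 16) with (-16) by ring.
    rewrite <- pow_add; f_equal; lia. }
rewrite (Rpow_mult_distr 4), (pow_mult 4); replace (4 ^ 2) with 16 by ring.
field; repeat split; apply INR_fact_neq_0.
Qed.

Lemma normal_even (N : nat) :
  c (2 * N + 2)%nat
  = sum_f_R0 (fun l => a l * pw (b l - 1 / 2) (2 * l + 1) (2 * N + 2)) N ->
  evenc c N / INR (2 * N + 1)
  = sum_f_R0 (fun i => (-1) ^ i * normal_coef (N - i)
    * normal_shift (N - i) ^ (2 * i + 1) / INR (fact (2 * i + 1))) N.
Proof.
intros E; unfold evenc; rewrite E, sum_f_R0_rev.
unfold Rdiv at 1 2.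
rewrite 2!Rmult_assoc, (Rmult_comm (sum_f_R0 _ _)), <- Rmult_assoc.
rewrite scal_sum; apply sum_eq; intros i Hi.
rewrite pw_odd_even by lia.
unfold Binomial.C, normal_coef, normal_shift.
replace (N - (N - i))%nat with i by lia.
replace (2 * N + 1 - (2 * i + 1))%nat with (2 * (N - i))%nat by lia.
replace ((-16) ^ N) with ((-16) ^ (N - i) * ((-1) ^ i * 16 ^ i)).
2:{ rewrite <- Rpow_mult_distr; replace (-1 * 16) with (-16) by ring.
    rewrite <- pow_add; f_equal; lia. }
rewrite (Rpow_mult_distr 4), (pow_add 4), (pow_mult 4).
replace (4 ^ 2) with 16 by ring.
rewrite (Nat.add_1_r (2 * N)), fact_simpl, mult_INR.
field; repeat split; try apply INR_fact_neq_0; apply not_0_INR; lia.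
Qed.

End Translation.

(** The coefficients of [W_n / (PI / 2)] minus the first [N + 1] terms of the
    expansion, whose shifts are [b] in the variable [n] and [b - 1 / 2] in the
    variable [n + 1 / 2]. *)
Definition remainder_coef (a b mu : nat -> R) (N j : nat) : R :=
  mu j - monomial 0 j - sum_f_R0 (fun l => a l * pw (b l) (2 * l + 1) j) N.

Lemma remainder_coef_half (a b mu c : nat -> R) (N m : nat) :
  (forall j, mu j = sum_f_R0 (fun k => c k * pw (1 / 2) k j) j) ->
  (forall j, (j <= m)%nat -> remainder_coef a b mu N j = 0) ->
  forall j, (j <= m)%nat ->
    remainder_coef a (fun l => b l - 1 / 2) c N j = 0.
Proof.
intros Hmu; apply (triangular_vanish _ _ (1 / 2)).
assert (forall l k j, pw (b l) k j
  = sum_f_R0 (fun i => pw (b l - 1 / 2) k i * pw (1 / 2) i j) j) as Hpw.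
{ intros l k; apply (expands_change_step _ _ (fun n => (/ (INR n + b l)) ^ k));
    [apply expands_inv_pow|apply expands_inv_pow_half]. }
assert (forall j, monomial 0 j
  = sum_f_R0 (fun i => monomial 0 i * pw (1 / 2) i j) j) as H0.
{ intros [|j]; [unfold monomial; simpl; ring|].
  rewrite sum_f_R0_0; [reflexivity|].
  intros [|i] _; unfold monomial; simpl; ring. }
intros j; unfold remainder_coef.
rewrite (sum_eq _ (fun k => (c k * pw (1 / 2) k j - monomial 0 k * pw (1 / 2) k j)
  - sum_f_R0 (fun l => a l * (pw (b l - 1 / 2) (2 * l + 1) k
                              * pw (1 / 2) k j)) N)
  j).
2:{ intros k _; rewrite 2!Rmult_minus_distr_r; f_equal.
    rewrite (Rmult_comm (sum_f_R0 _ _)), scal_sum.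
    apply sum_eq; intros; ring. }
rewrite 2!minus_sum, <- Hmu, <- H0; f_equal.
induction N as [|N IH].
- simpl sum_f_R0 at 1; rewrite Hpw, scal_sum.
  apply sum_eq; intros k _; simpl; ring.
- rewrite tech5, IH, Hpw.
  rewrite (sum_eq (fun k => sum_f_R0 _ (S N)) (fun k =>
    sum_f_R0 (fun l => a l * (pw (b l - 1 / 2) (2 * l + 1) k
                              * pw (1 / 2) k j)) N
    + pw (b (S N) - 1 / 2) (2 * S N + 1) k * pw (1 / 2) k j * a (S N)))
    by (intros k _; rewrite tech5; ring).
  rewrite plus_sum, <- scal_sum; reflexivity.
Qed.

Lemma remainder_coef_0 (a b mu : nat -> R) (N j : nat) :
  remainder_coef a b mu N j = 0 -> (1 <= j)%nat ->
  mu j = sum_f_R0 (fun l => a l * pw (b l) (2 * l + 1) j) N.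
Proof.
unfold remainder_coef; intros E Hj.
destruct j as [|j]; [lia|].
change (monomial 0 (S j)) with 0 in E; lra.
Qed.

(** * Non-vanishing of the coefficients *)

Section Induction.

Variables B c mu a b : nat -> R.
Hypothesis HB : is_bernoulli B.
Hypothesis Hc : exp_coefs (logc B) c.
Hypothesis Hmu : forall j, mu j = sum_f_R0 (fun k => c k * pw (1 / 2) k j) j.
Hypothesis Ha0 : a 0%nat = - (1 / 4).
Hypothesis Hb0 : b 0%nat = 5 / 8.
Hypothesis Ha : forall N, a (S N) = mu (2 * S N + 1)%nat
  - sum_f_R0 (fun l => a l * pw (b l) (2 * l + 1) (2 * S N + 1)) N.
Hypothesis Hb : forall N, b (S N) = - (1 / (INR (2 * S N + 1) * a (S N)))
  * (mu (2 * S N + 2)%nat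
     - sum_f_R0 (fun l => a l * pw (b l) (2 * l + 1) (2 * S N + 2)) N).

Let t := tanc B.
Let A := normal_coef a.
Let g := normal_shift b.

Lemma evenc_0 : evenc c 0 = 1 / 2.
Proof.
generalize (evenc_rec B c HB Hc 0) (oddc_0 B c HB Hc)
  (proj1 (tan_coefs_tanc B HB)); cbn -[oddc evenc tanc IZR]; intros E E1 E0.
rewrite E0, E1 in E; lra.
Qed.

Lemma normal_coef_0 : A 0 = 1.
Proof. unfold A, normal_coef; rewrite Ha0; simpl; field. Qed.

Lemma normal_shift_0 : g 0 = 1 / 2.
Proof. unfold g, normal_shift; rewrite Hb0; field. Qed.

Lemma remainder_coef_base (j : nat) :
  (j <= 2)%nat -> remainder_coef a b mu 0 j = 0.
Proof.
assert (c 0%nat = 1) as Hc0 by apply Hc.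
generalize (oddc_0 B c HB Hc) evenc_0; unfold oddc, evenc; simpl; intros H1 H2.
assert (c 1%nat = - (1 / 4)) as Hc1 by lra.
assert (c 2%nat = 1 / 32) as Hc2 by lra.
intros Hj; unfold remainder_coef, monomial; rewrite Hmu.
destruct j as [|[|[|j]]]; [| | |lia]; simpl;
  rewrite ?Hc0, ?Hc1, ?Hc2, ?Ha0, ?Hb0; field.
Qed.

Lemma remainder_coef_S (N j : nat) : remainder_coef a b mu (S N) j
  = remainder_coef a b mu N j - a (S N) * pw (b (S N)) (2 * S N + 1) j.
Proof. unfold remainder_coef; rewrite tech5; ring. Qed.

Lemma remainder_coef_odd (N : nat) :
  (forall j, (j <= 2 * N + 2)%nat -> remainder_coef a b mu N j = 0) ->
  forall j, (j <= 2 * S N + 1)%nat -> remainder_coef a b mu (S N) j = 0.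
Proof.
intros IH j Hj.
destruct (Nat.eq_dec j (2 * S N + 1)) as [->|Hne].
- unfold remainder_coef; rewrite tech5, pw_diag, Ha.
  rewrite Nat.add_1_r; change (monomial 0 (S _)) with 0; ring.
- rewrite remainder_coef_S, IH, pw_lt by lia; ring.
Qed.

(** The shift [b (S N)] enters this degree linearly, with coefficient proportional to [a (S N)]; its
    defining division must be a genuine one. *)
Lemma remainder_coef_even (N : nat) : a (S N) <> 0 ->
  remainder_coef a b mu (S N) (2 * S N + 2) = 0.
Proof.
intros Hne; unfold remainder_coef; rewrite tech5, pw_odd_even by lia.
rewrite Nat.sub_diag; unfold Binomial.C.
replace (2 * 0 + 1)%nat with 1%nat by lia.
replace (2 * S N + 1 - 1)%nat with (2 * S N)%nat by lia.
replace (monomial 0 (2 * S N + 2)) with 0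
  by (rewrite Nat.add_comm; reflexivity).
rewrite (Hb N); set (V := sum_f_R0 _ N).
assert (INR (2 * S N + 1) <> 0) as H1 by (apply not_0_INR; lia).
replace (fact (2 * S N + 1)) with ((2 * S N + 1) * fact (2 * S N))%nat
  by (rewrite Nat.add_1_r, fact_simpl; reflexivity).
rewrite mult_INR; change (fact 1) with 1%nat; change (INR 1) with 1.
field; repeat split; trivial; apply INR_fact_neq_0.
Qed.

Lemma half_equation (N j : nat) : (1 <= j)%nat ->
  (forall i, (i <= j)%nat -> remainder_coef a b mu N i = 0) ->
  c j = sum_f_R0 (fun l => a l * pw (b l - 1 / 2) (2 * l + 1) j) N.
Proof.
intros Hj H.
apply (remainder_coef_0 a (fun l => b l - 1 / 2)); trivial.
apply (remainder_coef_half a b mu c N j Hmu H); lia.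
Qed.

(** The case that [g_bound] does not reach, by exact values: [t_1 = 1 / 3], [p_1 = 1 / 4],
    [q_1 = 5 / 16], [A_1 = 3 / 8], [g_1 = 1 / 3]. *)
Lemma normal_shift_1 :
  oddc c 1 = sum_f_R0 (fun i => (-1) ^ i * A (1 - i)%nat
    * g (1 - i)%nat ^ (2 * i) / INR (fact (2 * i))) 1 ->
  evenc c 1 / INR (2 * 1 + 1) = sum_f_R0 (fun i => (-1) ^ i * A (1 - i)%nat
    * g (1 - i)%nat ^ (2 * i + 1) / INR (fact (2 * i + 1))) 1 ->
  Rabs (g 1%nat) <= 1 / 2.
Proof.
intros E3 E4.
generalize (oddc_rec B c HB Hc 0) (evenc_rec B c HB Hc 1)
  (proj2 (tan_coefs_tanc B HB) 0%nat) (proj1 (tan_coefs_tanc B HB)).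
cbn -[oddc evenc tanc IZR]; rewrite evenc_0, (oddc_0 B c HB Hc).
intros F1 F2 F3 F0; rewrite F0 in *.
assert (tanc B 1 = 1 / 3) as H1 by lra.
rewrite H1 in *.
assert (oddc c 1 = 1 / 4) as H2 by lra.
rewrite H2 in *.
assert (evenc c 1 = 5 / 16) as H3 by lra.
rewrite H3 in *.
simpl in E3, E4; rewrite normal_coef_0, normal_shift_0 in E3, E4.
assert (A 1%nat = 3 / 8) as H4 by lra.
rewrite H4 in E4.
assert (g 1%nat = 1 / 3) as -> by lra.
rewrite Rabs_pos_eq; lra.
Qed.

(** Both claims need each other: the odd degree gives [A (S N) > 0], hence [a (S N) <> 0], hence the
    even degree, whose equation bounds [g (S N)]. *)
Lemma remainder_coef_vanishes (N : nat) :
  (forall j, (j <= 2 * N + 2)%nat -> remainder_coef a b mu N j = 0)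
  /\ bounded_upto t A g N.
Proof.
induction N as [|N [IH1 IH2]].
- split; [intros j Hj; apply remainder_coef_base; lia|].
  intros m Hm; replace m with 0%nat by lia.
  rewrite normal_coef_0, normal_shift_0.
  unfold t; rewrite (proj1 (tan_coefs_tanc B HB)).
  split; [lra|rewrite Rabs_pos_eq; lra].
- generalize (tan_coefs_tanc B HB); intros Ht.
  generalize (remainder_coef_odd N IH1); intros Hodd.
  assert (oddc c (S N) = sum_f_R0 (fun i => (-1) ^ i * A (S N - i)%nat
    * g (S N - i)%nat ^ (2 * i) / INR (fact (2 * i))) (S N)) as E3
    by (apply normal_odd, half_equation; trivial; lia).
  destruct (A_bounds t A g Ht N (oddc c (S N)) IH2) as [HA0 HA1].
  { split; [apply (oddc_lower B c HB Hc)|apply (oddc_evenc_bounds B c HB Hc)]. }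
  { exact E3. }
  assert (0 < A (S N)) as HA.
  { eapply Rlt_le_trans; [|exact HA0].
    apply Rmult_lt_0_compat; [|apply (tan_coefs_bounds t Ht)].
    assert (1 <= INR (S N)) as HS by (rewrite S_INR; generalize (pos_INR N); lra).
    assert (9 / (16 * INR (S N)) <= 9 / 16); [|lra].
    apply Rmult_le_compat_l; [lra|apply Rinv_le_contravar; lra]. }
  assert (a (S N) <> 0) as Hne.
  { intros E; unfold A, normal_coef in HA; rewrite E in HA.
    unfold Rdiv in HA; rewrite Rmult_0_r, Rmult_0_l in HA; lra. }
  assert (forall j, (j <= 2 * S N + 2)%nat -> remainder_coef a b mu (S N) j = 0)
    as Heven.
  { intros j Hj; destruct (Nat.eq_dec j (2 * S N + 2)) as [->|Hj'].
    - apply remainder_coef_even, Hne.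
    - apply Hodd; lia. }
  split; trivial.
  assert (evenc c (S N) / INR (2 * S N + 1)
    = sum_f_R0 (fun i => (-1) ^ i * A (S N - i)%nat
      * g (S N - i)%nat ^ (2 * i + 1) / INR (fact (2 * i + 1))) (S N)) as E4
    by (apply normal_even, half_equation; trivial; lia).
  intros m Hm; destruct (Nat.eq_dec m (S N)) as [->|Hm']; [|apply IH2; lia].
  split; [lra|].
  destruct N as [|N]; [apply normal_shift_1; trivial|].
  apply (g_bound t A g Ht (S N) (evenc c (S (S N)))); trivial; [lia|].
  apply (oddc_evenc_bounds B c HB Hc).
Qed.

End Induction.

(* [Binomial.C n k] is the real binomial coefficient; it is qualified because
   Coquelicot uses [C] for the complex numbers. *)
Theorem theorem3p1
  (B nu mu alpha beta : nat -> R)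
  (hB : is_bernoulli B)
  (hnu : forall j : nat, (1 <= j)%nat ->
     nu j = (-1) ^ (j + 1)
            * ((4 - powerRZ 2 (1 - Z.of_nat j)) * B (j + 1)%nat
               - INR (j + 1) * powerRZ 2 (- Z.of_nat j))
            / (INR j * INR (j + 1)))
  (hmu0 : mu 0%nat = 1)
  (hmu : forall j : nat, (1 <= j)%nat ->
     mu j = 1 / INR j * sum_n_m (fun k => INR k * nu k * mu (j - k)%nat) 1 j)
  (halpha1 : alpha 1%nat = - (1 / 4))
  (hbeta1 : beta 1%nat = 5 / 8)
  (halpha : forall l : nat, (2 <= l)%nat ->
     alpha l = mu (2 * l - 1)%nat
       - sum_n_m (fun k => alpha k * beta k ^ (2 * l - 2 * k)
                           * Binomial.C (2 * l - 2) (2 * l - 2 * k)) 1 (l - 1))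
  (hbeta : forall l : nat, (2 <= l)%nat ->
     beta l = - (1 / (INR (2 * l - 1) * alpha l))
       * (mu (2 * l)%nat
          + sum_n_m (fun k => alpha k * beta k ^ (2 * l - 2 * k + 1)
                       * Binomial.C (2 * l - 1) (2 * l - 2 * k + 1)) 1 (l - 1))) :
  asymptotic_expansion wallis (PI / 2) alpha beta.
Proof.
destruct (exp_coefs_exists (logc B)) as [c Hc].
assert (expands half_step c (fun n => wallis n / (PI / 2))) as Xc.
{ apply (expands_exp_log_wallis half_step (logc B)); trivial.
  - exact half_step_lim.
  - apply expands_log_wallis, hB. }
assert (expands (fun n => / INR n) mu (fun n => wallis n / (PI / 2))) as Xmu.
{ apply (expands_exp_log_wallis _
    (fun j => sum_f_R0 (fun k => logc B k * pw (1 / 2) k j) j)).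
  - exact inv_INR_lim.
  - simpl; ring.
  - exact (exp_coefs_mu B nu mu hB hnu hmu0 hmu).
  - apply (expands_reexpand _ half_step);
      [exact inv_INR_lim|exact half_step_inv_INR|apply expands_log_wallis, hB]. }
set (a := fun l => alpha (S l)); set (b := fun l => beta (S l)).
intros [|N] HN; [lia|].
destruct (remainder_coef_vanishes B c mu a b hB Hc
  (expands_change_step _ _ _ Xmu Xc) halpha1 hbeta1) with (N := N) as [H0 _].
- intros M; unfold a at 1; rewrite halpha by lia.
  replace (2 * S (S M) - 1)%nat with (2 * S M + 1)%nat by lia.
  replace (S (S M) - 1)%nat with (S M) by lia.
  rewrite sum_n_m_from_1; f_equal.
  apply sum_eq; intros l Hl; unfold a, b.
  rewrite pw_odd_odd by lia.
  replace (2 * S (S M) - 2)%nat with (2 * S M)%nat by lia.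
  replace (2 * S (S M) - 2 * S l)%nat with (2 * (S M - l))%nat by lia.
  ring.
- intros M; unfold b at 1; rewrite hbeta by lia.
  replace (2 * S (S M) - 1)%nat with (2 * S M + 1)%nat by lia.
  replace (2 * S (S M))%nat with (2 * S M + 2)%nat by lia.
  replace (S (S M) - 1)%nat with (S M) by lia.
  rewrite sum_n_m_from_1; f_equal.
  unfold Rminus; f_equal.
  rewrite <- (Rmult_1_l (sum_f_R0 (fun l => a l * _) M)), Ropp_mult_distr_l.
  rewrite scal_sum; apply sum_eq; intros l Hl; unfold a, b.
  rewrite pw_odd_even by lia.
  replace (2 * S M + 2 - 2 * S l + 1)%nat with (2 * (S M - l) + 1)%nat by lia.
  ring.
- assert (expands (fun n => / INR n) (remainder_coef a b mu N)
    (fun n => wallis n / (PI / 2) - 1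
      - sum_f_R0 (fun l => a l * (/ (INR n + b l)) ^ (2 * l + 1)) N)) as X.
  { apply (expands_ext _ (fun j => mu j + (-1) * monomial 0 j
        + (-1) * sum_f_R0 (fun l => a l * pw (b l) (2 * l + 1) j) N) _
      (fun n => wallis n / (PI / 2) + (-1) * (/ INR n) ^ 0
        + (-1) * sum_f_R0 (fun l => a l * (/ (INR n + b l)) ^ (2 * l + 1)) N)).
    - intros j; unfold remainder_coef; ring.
    - exists 0%nat; intros n _; simpl; ring.
    - apply expands_lin.
      + apply expands_lin; trivial.
        apply (expands_taylor _ _ (fun x => x ^ 0));
          [exact inv_INR_lim|apply taylor_monomial].
      + apply (expands_sum _ (fun l => pw (b l) (2 * l + 1))
          (fun l n => (/ (INR n + b l)) ^ (2 * l + 1))).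
        intros l; apply expands_inv_pow. }
  (* All coefficients up to this degree vanish, so the remainder is of order [2 N + 3], the exponent
     required for [S N] terms. *)
  destruct (X (2 * N + 2)%nat) as [K [n0 HK]].
  exists (PI / 2 * K); exists (S n0); intros n Hn.
  specialize (HK n ltac:(lia)).
  rewrite (sum_f_R0_0 (fun j => remainder_coef a b mu N j * _)) in HK by (intros j Hj; rewrite H0 by lia; ring).
  rewrite Rminus_0_r in HK.
  assert (0 < PI / 2) as Hpi by (generalize PI_RGT_0; lra).
  replace (-2 * Z.of_nat (S N) - 1)%Z with (- Z.of_nat (S (2 * N + 2)))%Z by lia.
  rewrite powerRZ_neg', <- pow_powerRZ, Rabs_inv, <- RPow_abs, <- pow_inv, <- Rabs_inv.
  rewrite sum_n_m_from_1.
  replace (wallis n - _) with (PI / 2 * (wallis n / (PI / 2) - 1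
    - sum_f_R0 (fun l => a l * (/ (INR n + b l)) ^ (2 * l + 1)) N)).
  + rewrite Rabs_mult, (Rabs_pos_eq (PI / 2)), Rmult_assoc by lra.
    apply Rmult_le_compat_l; [lra|exact HK].
  + rewrite (sum_eq (fun l => a l * _) (fun k =>
      alpha (S k) / (INR n + beta (S k)) ^ (2 * S k - 1))).
    * field; lra.
    * intros l _; rewrite pow_inv; unfold a, b, Rdiv.
      replace (2 * S l - 1)%nat with (2 * l + 1)%nat by lia; reflexivity.
Qed.
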